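(* Let $\Pi(x,y)$ be a self-adjoint Hermitian projection kernel on $\mathbb{R}$ (inducing a locally trace class projection operator), let $\mathbb{P}_\Pi$ be the corresponding determinantal point process on $\mathbb{R}$, and let $U\subset\mathbb{R}$ be an open subset. Let $\tilde\Pi(z,w)$ be a function of $z,w\in\mathbb{C}$ that is entire in $z$ for any fixed $w$, satisfies $\tilde\Pi(z,w)=\overline{\tilde\Pi(w,z)}$, and assumes real values as soon as $z,w$ range over $\mathbb{R}$. Assume that there exist constants $A>0$, $M>0$, $\sigma>0$ and a positive continuous function $\rho$ on $U$, bounded above, such that for any $p\in U$ $$|\tilde\Pi(p,z)|\le Ae^{M|z-p|^\sigma}\quad\text{for all } z\in\mathbb{C},$$ and for any $x,y\in U$ $$\Pi(x,y)=\rho(x)\rho(y)\tilde\Pi(x,y).$$ Let $q\colon\mathbb{R}^2\to\mathbb{C}$ be a function of two variables such that $\|q\|_{(1,\infty)}<+\infty$. Then there exists a positive constant $c$, depending only on $A$, $M$, $\sigma$ and $\sup_U\rho$, such that for all $\lambda>0$ we have $$\mathbb{E}_{\mathbb{P}_\Pi}\exp(\lambda\mathbf{S}_q)\le\exp\bigl(c\bigl(\exp(\|q\|_{(1,\infty)}\lambda\sigma)-1\bigr)\bigr).$$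
   Context: The determinantal point process $\mathbb{P}_\Pi$ is the point process whose $n$-th correlation function with respect to Lebesgue measure is $\det(\Pi(x_i,x_j))_{i,j=1,\dots,n}$ for every $n$. For a function $q\colon\mathbb{R}^2\to\mathbb{C}$, $$\|q\|_{(1,\infty)}=\sum_{k,l\in\mathbb{Z}}\ \max_{|x-k|\le1,\ |y-l|\le1}|q(x,y)|,$$ and for a configuration $X$, $\mathbf{S}_q(X)=\sum_{x\in X,\,y\in X}q(x,y)$ is the additive functional over pairs of particles.
   Formalization: The formal theorem additionally assumes that q vanishes outside U×U (so S_q only sees pairs of particles in U); without this the claim fails, since nothing controls the particles outside U. *)

(* Defs.v *)
From HB Require Import structures.
From mathcomp Require Import all_boot all_order all_algebra.
From mathcomp Require Import all_classical all_reals all_analysis.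
From mathcomp Require Import complex.

Set Implicit Arguments.
Unset Strict Implicit.
Unset Printing Implicit Defensive.

Import Order.TTheory GRing.Theory Num.Theory.
Import numFieldNormedType.Exports.
Import ComplexField.Normc.

Local Open Scope classical_set_scope.
Local Open Scope ring_scope.
Local Open Scope complex_scope.

Record configuration (R : realType) := Configuration {
  points :> set R;
  locally_finite_points : forall a b : R, finite_set (points `&` `[a, b]) }.

HB.instance Definition _ (R : realType) := gen_eqMixin (configuration R).
HB.instance Definition _ (R : realType) := gen_choiceMixin (configuration R).

Lemma locally_finite_set0 (R : realType) (a b : R) :
  finite_set ((set0 : set R) `&` `[a, b]).
Proof. by rewrite set0I; exact: finite_set0. Qed.

HB.instance Definition _ (R : realType) :=
  isPointed.Build (configuration R) (Configuration (@locally_finite_set0 R)).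

Definition count_events (R : realType) : set (set (configuration R)) :=
  [set E | exists (a b : R) (B : set R) (n : nat),
    [/\ measurable B, B `<=` `[a, b] &
        E = [set X : configuration R | (points X `&` B #= `I_n)%card]]].

(* The space of configurations with the sigma-algebra generated by the numbers
   of particles in bounded Borel sets. *)
Definition Conf (R : realType) := g_sigma_algebraType (@count_events R).

Definition distinct_tuples (R : realType) (n : nat) (X : set R) :
    set (n.-tuple R) :=
  [set t : n.-tuple R | uniq t /\ forall i, X (tnth t i)].

(* Lebesgue integral over R^n as an iterated integral; the two agree by Tonelli
   for the almost everywhere nonnegative integrands met here. *)
Fixpoint lebesgue_int_tuple (R : realType) (n : nat) :
    (n.-tuple R -> \bar R) -> \bar R :=
  match n with
  | 0 => fun F => F [tuple]
  | m.+1 => fun F =>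
      (\int[@lebesgue_measure R]_x
         lebesgue_int_tuple (fun t : m.-tuple R => F [tuple of x :: t]))%E
  end.

(* rho is the n-th correlation function of P with respect to Lebesgue measure:
   E (\sum f(x_1, ..., x_n)) over ordered n-tuples of distinct particles is the
   integral of f * rho. *)
Definition is_correlation (R : realType) (P : probability (Conf R) R)
    (n : nat) (rho : n.-tuple R -> R) : Prop :=
  forall f : n.-tuple R -> R, measurable_fun setT f -> (forall t, 0 <= f t) ->
  ((\int[P]_X \esum_(t in distinct_tuples (X : configuration R)) (f t)%:E) =
   lebesgue_int_tuple (fun t => (f t * rho t)%:E))%E.

(* For a Hermitian kernel the determinant is real, so Re loses nothing. *)
Definition determinantal (R : realType) (K : R -> R -> R[i])
    (P : probability (Conf R) R) : Prop :=
  forall n : nat, is_correlation P (fun t : n.-tuple R =>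
    complex.Re (\det (\matrix_(i < n, j < n) K (tnth t i) (tnth t j)))).

Definition cintegral (R : realType) (f : R -> R[i]) : R[i] :=
  Complex (Rintegral (@lebesgue_measure R) setT (fun x => complex.Re (f x)))
          (Rintegral (@lebesgue_measure R) setT (fun x => complex.Im (f x))).

Definition cintegrable (R : realType) (f : R -> R[i]) : Prop :=
  (@lebesgue_measure R).-integrable setT (fun x => (complex.Re (f x))%:E) /\
  (@lebesgue_measure R).-integrable setT (fun x => (complex.Im (f x))%:E).

Definition L2 (R : realType) (f : R -> R[i]) : Prop :=
  [/\ measurable_fun setT (fun x => complex.Re (f x)),
      measurable_fun setT (fun x => complex.Im (f x)) &
      (\int[@lebesgue_measure R]_x (normc (f x) ^+ 2)%:E < +oo)%E].

Definition inner (R : realType) (f g : R -> R[i]) : R[i] :=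
  cintegral (fun x => f x * (g x)^*).

Definition kernel_op (R : realType) (K : R -> R -> R[i]) (f : R -> R[i]) :
    R -> R[i] :=
  fun x => cintegral (fun y => K x y * f y).

Definition acts_on_L2 (R : realType) (K : R -> R -> R[i]) : Prop :=
  forall f, L2 f ->
    {ae @lebesgue_measure R, forall x, cintegrable (fun y => K x y * f y)} /\
    L2 (kernel_op K f).

Definition orthonormal (R : realType) (m : nat) (e : 'I_m -> R -> R[i]) : Prop :=
  (forall i, L2 (e i)) /\ forall i j, inner (e i) (e j) = (i == j)%:R.

(* Trace norm as the supremum of \sum |<K e_i, f_i>| over finite orthonormal
   families. *)
Definition trace_class (R : realType) (K : R -> R -> R[i]) : Prop :=
  exists C : R, forall (m : nat) (e f : 'I_m -> R -> R[i]),
    orthonormal e -> orthonormal f ->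
    \sum_(i < m) normc (inner (kernel_op K (e i)) (f i)) <= C.

Definition locally_trace_class (R : realType) (K : R -> R -> R[i]) : Prop :=
  forall a b : R, trace_class (fun x y =>
    (\1_`[a, b] x : R)%:C * K x y * (\1_`[a, b] y : R)%:C).

Record projection_kernel (R : realType) (K : R -> R -> R[i]) : Prop := {
  kernel_measurable_Re :
    measurable_fun [set: R * R] (fun xy => complex.Re (K xy.1 xy.2));
  kernel_measurable_Im :
    measurable_fun [set: R * R] (fun xy => complex.Im (K xy.1 xy.2));
  kernel_hermitian : forall x y, K x y = (K y x)^*;
  kernel_L2 : acts_on_L2 K;
  kernel_selfadjoint : forall f g, L2 f -> L2 g ->
    inner (kernel_op K f) g = inner f (kernel_op K g);
  kernel_idempotent : forall f, L2 f ->
    {ae @lebesgue_measure R, forall x,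
      kernel_op K (kernel_op K f) x = kernel_op K f x};
  kernel_locally_trace_class : locally_trace_class K }.

Definition entire (R : realType) (f : R[i] -> R[i]) : Prop :=
  forall z : R[i], derivable (f : R[i]^o -> R[i]^o) z 1.

Definition cexp (R : realType) (z : R[i]) : R[i] :=
  (expR (complex.Re z))%:C * Complex (cos (complex.Im z)) (sin (complex.Im z)).

(* The supremum over each closed square stands for the maximum, since q need not
   be continuous. *)
Definition norm1oo (R : realType) (q : R -> R -> R[i]) : \bar R :=
  \esum_(kl in [set: int * int])
    ereal_sup [set (normc (q xy.1 xy.2))%:E | xy in
      [set xy : R * R | `|xy.1 - kl.1%:~R| <= 1 /\ `|xy.2 - kl.2%:~R| <= 1]].

(* Sum of an absolutely summable family; a junk value otherwise. *)
Definition rsum (R : realType) (T : choiceType) (D : set T) (f : T -> R) : R :=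
  fine (\esum_(i in D) (Num.max (f i) 0)%:E) -
  fine (\esum_(i in D) (Num.max (- f i) 0)%:E).

(* The sum of q(x, y) over all ordered pairs of particles, including x = y. *)
Definition pair_functional (R : realType) (q : R -> R -> R[i])
    (X : configuration R) : R[i] :=
  Complex (rsum (points X `*` points X) (fun xy => complex.Re (q xy.1 xy.2)))
          (rsum (points X `*` points X) (fun xy => complex.Im (q xy.1 xy.2))).

Definition pair_summable (R : realType) (q : R -> R -> R[i])
    (X : configuration R) : Prop :=
  summable (points X `*` points X) (fun xy => (normc (q xy.1 xy.2))%:E).

(* Main.v *)
Require Import Defs.
From HB Require Import structures.
From mathcomp Require Import all_boot all_order all_algebra.
From mathcomp Require Import all_classical all_reals all_analysis.
From mathcomp Require Import measurable_realfun complex perm finmap ring lra.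

Set Implicit Arguments.
Unset Strict Implicit.
Unset Printing Implicit Defensive.

Import Order.TTheory GRing.Theory Num.Theory.
Import numFieldNormedType.Exports.
Import ComplexField.Normc.

Local Open Scope classical_set_scope.
Local Open Scope ring_scope.
Local Open Scope complex_scope.

(* Let N be the number of particles in an interval I of length 2 meeting U. The
   probability of N >= n is at most the integral of det(Pi(x_i, x_j)) over the
   n-tuples of I. Newton interpolation of the entire functions Pi~(., x_j) at
   x_1, ..., x_n turns the determinant into that of their divided differences,
   and the maximum principle on a square of half-side comparable to
   k^(1/sigma) bounds the k-th one by C^k k^(-k/sigma). Hence
   P(N >= n) <= exp(O(n^2) - n^2 ln n / (2 sigma)), and therefore
   E exp(t N^2) <= exp(c (exp(4 sigma t) - 1)).
   Every pair of particles lies in at least four of the squares defining the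
   norm, so S_q <= 1/4 \sum_(k, l) a_(k, l) N_k N_l with \sum a_(k, l) = ||q||,
   and Jensen's inequality reduces the exponential moment of S_q to the one above
   with t = lambda ||q|| / 4. *)

(** * Complex analysis *)

(** The divided differences are quotients whose differentiability at their own nodes is not at hand.
    Goursat's theorem is therefore proved for functions that are continuous everywhere and
    differentiable off a finite set: forming a slope merely adds its base point to that set, and
    removable singularities never come up. Only the imaginary part of a contour integral is needed:
    after a rotation the value at [z] is a nonnegative real, and the contribution of [1 / (w - z)]
    has a definite sign on each side of the square, so no winding number is computed.

    The halved coefficient of [n ^ 2 * ln n] is that of the sum of [k * ln k]. The 4 in
    [expR (4 * sigma * t)] cancels the quarter gained from the four squares, which leaves exactly
    [lambda * sigma] times the norm of [q].

    Nothing makes [q] measurable, hence neither the exponential of the pair sum. It is bounded by an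
    explicit measurable majorant, and integrals are compared as suprema over simple functions. The
    finiteness of such a majorant almost everywhere also yields the summability over pairs. *)

Section SegmentIntegral.
Context {R : realType}.
Implicit Types (f g : R -> R) (a b c m e : R).

Definition seg_int a b f : R := \int[@lebesgue_measure R]_(x in `[a, b]) f x.

Lemma continuous_integrable a b f : continuous f ->
  (@lebesgue_measure R).-integrable `[a, b] (EFin \o f).
Proof.
move=> cf; apply: continuous_compact_integrable; first exact: segment_compact.
exact: continuous_subspaceT.
Qed.

Lemma seg_int_split a b c f : continuous f -> a <= b -> b <= c ->
  seg_int a c f = seg_int a b f + seg_int b c f.
Proof.
move=> cf ab bc; apply/eqP; rewrite addrC -subr_eq; apply/eqP.
rewrite /seg_int Rintegral_itvB ?bnd_simp//; last exact: continuous_integrable.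
rewrite Rintegral_itv_obnd_cbnd//.
apply: (integrableS _ _ _ (continuous_integrable b c cf)) => //.
by apply: subset_itvr; rewrite bnd_simp.
Qed.

Lemma seg_intD a b f g : continuous f -> continuous g ->
  seg_int a b (fun x => f x + g x) = seg_int a b f + seg_int a b g.
Proof.
by move=> cf cg; rewrite /seg_int RintegralD//; exact: continuous_integrable.
Qed.

Lemma seg_int_cst a b c : a <= b -> seg_int a b (fun=> c) = c * (b - a).
Proof.
move=> ab; rewrite /seg_int Rintegral_cst//= lebesgue_measure_itv/= lte_fin.
by move: ab; rewrite le_eqVlt => /orP[/eqP<-|->//]; rewrite ltxx subrr.
Qed.

Lemma seg_int_le a b c f : continuous f -> a <= b ->
  (forall x, a <= x <= b -> f x <= c) -> seg_int a b f <= c * (b - a).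
Proof.
move=> cf ab fc; rewrite -(seg_int_cst c ab); apply: le_Rintegral.
- by [].
- exact: continuous_integrable.
- by apply: continuous_integrable => x; exact: cvg_cst.
- by move=> x /=; rewrite in_itv/=; exact: fc.
Qed.

Lemma seg_int_ge a b c f : continuous f -> a <= b ->
  (forall x, a <= x <= b -> c <= f x) -> c * (b - a) <= seg_int a b f.
Proof.
move=> cf ab fc; rewrite -(seg_int_cst c ab); apply: le_Rintegral.
- by [].
- by apply: continuous_integrable => x; exact: cvg_cst.
- exact: continuous_integrable.
- by move=> x /=; rewrite in_itv/=; exact: fc.
Qed.

End SegmentIntegral.

Section ComplexModulus.
Context {R : realType}.
Implicit Types z w : R[i].

Lemma normcB_le z w : normc (z - w) <= normc z + normc w.
Proof. by rewrite -[normc w]normcN; exact: le_normcD. Qed.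

Lemma normcD_le z w : normc (z + w) <= normc z + normc w.
Proof. exact: le_normcD. Qed.

Lemma normc_opp z : normc (- z) = normc z.
Proof. exact: normcN. Qed.

Lemma normc_ge0 z : 0 <= normc z.
Proof. by case: z => x y; exact: sqrtr_ge0. Qed.

Lemma normc_eq0 z : (normc z == 0) = (z == 0).
Proof.
by apply/eqP/eqP => [/eq0_normc//|->]; rewrite normc0.
Qed.

Lemma normc_gt0 z : (0 < normc z) = (z != 0).
Proof. by rewrite lt_def normc_ge0 andbT normc_eq0. Qed.

Lemma normcX z n : normc (z ^+ n) = normc z ^+ n.
Proof.
by elim: n => [|n IH]; rewrite ?expr0 ?normc1// !exprS normcM IH.
Qed.

Lemma normcC z w : normc (z - w) = normc (w - z).
Proof. by rewrite -normc_opp opprB. Qed.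

Lemma Re_le_normc z : `|complex.Re z| <= normc z.
Proof.
case: z => x y /=; rewrite -sqrtr_sqr ler_wsqrtr// lerDl; exact: sqr_ge0.
Qed.

Lemma Im_le_normc z : `|complex.Im z| <= normc z.
Proof.
case: z => x y /=; rewrite -sqrtr_sqr ler_wsqrtr// lerDr; exact: sqr_ge0.
Qed.

Lemma normc_le_ReIm z : normc z <= `|complex.Re z| + `|complex.Im z|.
Proof.
case: z => x y /=.
rewrite -[leRHS]ger0_norm ?addr_ge0// -sqrtr_sqr ler_wsqrtr//.
rewrite sqrrD !real_normK ?num_real// -addrA lerD2l lerDr.
by rewrite mulrn_wge0// mulr_ge0.
Qed.

Lemma normcR (x : R) : normc x%:C = `|x|.
Proof. by rewrite /= expr0n/= addr0 sqrtr_sqr. Qed.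

Lemma ReB z w : complex.Re (z - w) = complex.Re z - complex.Re w.
Proof. by case: z; case: w. Qed.

Lemma ImB z w : complex.Im (z - w) = complex.Im z - complex.Im w.
Proof. by case: z; case: w. Qed.

(** Stated with real radii, whereas the norm of [R[i]] takes its values in [R[i]]. The passage from
    [derivable] is [derivable_cderivable]. *)
Definition ccont (f : R[i] -> R[i]) z := forall e : R, 0 < e ->
  exists2 d : R, 0 < d & forall w, normc (w - z) < d -> normc (f w - f z) <= e.

Definition cderiv (f : R[i] -> R[i]) z (l : R[i]) := forall e : R, 0 < e ->
  exists2 d : R, 0 < d & forall w, normc (w - z) < d ->
    normc (f w - f z - l * (w - z)) <= e * normc (w - z).

Definition cderivable f z := exists l, cderiv f z l.

End ComplexModulus.

(** * Contour integrals along the boundary of a rectangle *)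

Section BoundaryIntegral.
Context {R : realType}.
Implicit Types (h : R[i] -> R[i]) (a b c d m : R).

(* The imaginary part of the contour integral of [h] along the boundary of
   [a, b] x [c, d]. *)
Definition box_int h a b c d : R :=
  seg_int c d (fun y => complex.Re (h (b +i* y)) - complex.Re (h (a +i* y))) -
  seg_int a b (fun x => complex.Im (h (x +i* d)) - complex.Im (h (x +i* c))).

Variable h : R[i] -> R[i].
Hypothesis ch : forall z, ccont h z.

Lemma continuous_Re_vert b : continuous (fun y => complex.Re (h (b +i* y))).
Proof.
move=> y; apply/cvgrPdist_le => e e0.
have [d d0 hd] := ch (b +i* y) e0.
near=> y'; rewrite -ReB; apply: (le_trans (Re_le_normc _)).
rewrite normcC; apply: hd; apply: (le_lt_trans (normc_le_ReIm _)) => /=.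
rewrite subrr normr0 add0r distrC.
by near: y'; apply: (@cvgr_dist_lt _ _ _ _ _ _ y) => //; exact: cvg_id.
Unshelve. all: by end_near. Qed.

Lemma continuous_Im_hor c : continuous (fun x => complex.Im (h (x +i* c))).
Proof.
move=> x; apply/cvgrPdist_le => e e0.
have [d d0 hd] := ch (x +i* c) e0.
near=> x'; rewrite -ImB; apply: (le_trans (Im_le_normc _)).
rewrite normcC; apply: hd; apply: (le_lt_trans (normc_le_ReIm _)) => /=.
rewrite subrr normr0 addr0 distrC.
by near: x'; apply: (@cvgr_dist_lt _ _ _ _ _ _ x) => //; exact: cvg_id.
Unshelve. all: by end_near. Qed.

Lemma continuous_Re_diff a b :
  continuous (fun y => complex.Re (h (b +i* y)) - complex.Re (h (a +i* y))).
Proof. by move=> y; apply: cvgB; exact: continuous_Re_vert. Qed.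

Lemma continuous_Im_diff c d :
  continuous (fun x => complex.Im (h (x +i* d)) - complex.Im (h (x +i* c))).
Proof. by move=> y; apply: cvgB; exact: continuous_Im_hor. Qed.

Lemma box_int_splitx m a b c d : a <= m -> m <= b ->
  box_int h a b c d = box_int h a m c d + box_int h m b c d.
Proof.
move=> am mb; rewrite /box_int (seg_int_split (@continuous_Im_diff c d) am mb).
under [in LHS]eq_fun.
  move=> y; rewrite -(subrK (complex.Re (h (m +i* y))) (complex.Re (h (b +i* y)))).
  rewrite -addrA; over.
rewrite (seg_intD _ _ (@continuous_Re_diff m b) (@continuous_Re_diff a m)).
lra.
Qed.

Lemma box_int_splity m a b c d : c <= m -> m <= d ->
  box_int h a b c d = box_int h a b c m + box_int h a b m d.
Proof.
move=> cm md; rewrite /box_int (seg_int_split (@continuous_Re_diff a b) cm md).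
under [X in _ - seg_int _ _ X = _]eq_fun.
  move=> y; rewrite -(subrK (complex.Im (h (y +i* m))) (complex.Im (h (y +i* d)))).
  rewrite -addrA; over.
rewrite (seg_intD _ _ (@continuous_Im_diff m d) (@continuous_Im_diff c m)).
lra.
Qed.

(* An error estimate, since the contour integral of [al + be * z] vanishes. *)
Lemma box_int_affine_approx a b c d (al be : R[i]) (e : R) :
  a <= b -> c <= d ->
  (forall x y, a <= x <= b -> c <= y <= d ->
    normc (h (x +i* y) - (al + be * (x +i* y))) <= e) ->
  `|box_int h a b c d| <= 2 * e * ((b - a) + (d - c)).
Proof.
move=> ab cd he.
have Rbnd y : c <= y <= d ->
    complex.Re be * (b - a) - 2 * e <=
      complex.Re (h (b +i* y)) - complex.Re (h (a +i* y)) <=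
    complex.Re be * (b - a) + 2 * e.
  move=> cyd.
  have := le_trans (Re_le_normc _) (he b y _ cyd).
  have := le_trans (Re_le_normc _) (he a y _ cyd).
  rewrite !lexx ab !ReB => /(_ isT) + /(_ isT).
  case: be al he => b1 b2 [a1 a2] _ /=; rewrite !ler_norml; lra.
have Ibnd x : a <= x <= b ->
    complex.Re be * (d - c) - 2 * e <=
      complex.Im (h (x +i* d)) - complex.Im (h (x +i* c)) <=
    complex.Re be * (d - c) + 2 * e.
  move=> axb.
  have := le_trans (Im_le_normc _) (he x d axb _).
  have := le_trans (Im_le_normc _) (he x c axb _).
  rewrite !lexx cd !ImB => /(_ isT) + /(_ isT).
  case: be al he Rbnd => b1 b2 [a1 a2] _ /= _; rewrite !ler_norml; lra.
have := seg_int_le (@continuous_Re_diff a b) cd (fun y H => proj2 (andP (Rbnd y H))).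
have := seg_int_ge (@continuous_Re_diff a b) cd (fun y H => proj1 (andP (Rbnd y H))).
have := seg_int_le (@continuous_Im_diff c d) ab (fun y H => proj2 (andP (Ibnd y H))).
have := seg_int_ge (@continuous_Im_diff c d) ab (fun y H => proj1 (andP (Ibnd y H))).
rewrite /box_int ler_norml.
set I1 := seg_int _ _ _; set I2 := seg_int _ _ _; clearbody I1 I2.
nra.
Qed.

End BoundaryIntegral.

(** * Goursat's theorem with finitely many exceptional points *)

Section Goursat.
Context {R : realType}.
Implicit Types (h : R[i] -> R[i]) (a b c d m : R) (E : seq R[i]).

(* [sg (x - e) * sqrt `|x - e|], since [Num.sqrt] vanishes on negative
   numbers. *)
Definition signed_sqrt (e x : R) := Num.sqrt (x - e) - Num.sqrt (e - x).

Lemma signed_sqrt_homo e a b : a <= b -> signed_sqrt e a <= signed_sqrt e b.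
Proof. by move=> ab; apply: lerB; apply: ler_wsqrtr; lra. Qed.

(** Subadditivity of the square root, for the two parts into which [e] cuts the interval. *)
Lemma signed_sqrt_incr e a b : a <= e <= b ->
  Num.sqrt (b - a) <= signed_sqrt e b - signed_sqrt e a.
Proof.
move=> /andP[ae eb]; rewrite /signed_sqrt.
rewrite (@ler0_sqrtr _ (e - b)) ?subr_le0// (@ler0_sqrtr _ (a - e)) ?subr_le0//.
set u := Num.sqrt (b - e); set v := Num.sqrt (e - a).
have u2 : u ^+ 2 = b - e by rewrite sqr_sqrtr ?subr_ge0.
have v2 : v ^+ 2 = e - a by rewrite sqr_sqrtr ?subr_ge0.
have u0 : 0 <= u by exact: sqrtr_ge0.
have v0 : 0 <= v by exact: sqrtr_ge0.
have -> : u - 0 - (0 - v) = u + v by lra.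
rewrite -[leRHS]ger0_norm ?addr_ge0// -sqrtr_sqr ler_wsqrtr//.
rewrite sqrrD u2 v2; have := mulr_ge0 u0 v0; lra.
Qed.

Definition weight (s : seq R) (x : R) := x + \sum_(e <- s) signed_sqrt e x.

Lemma weight_incr s a b : a <= b -> b - a <= weight s b - weight s a.
Proof.
move=> ab; rewrite /weight.
have : \sum_(e <- s) signed_sqrt e a <= \sum_(e <- s) signed_sqrt e b.
  by apply: ler_sum => e _; exact: signed_sqrt_homo.
lra.
Qed.

Lemma weight_incr_sqrt s e a b : e \in s -> a <= e <= b ->
  Num.sqrt (b - a) <= weight s b - weight s a.
Proof.
move=> es aeb; have ab : a <= b by case/andP: aeb; exact: le_trans.
rewrite /weight !(big_rem e es)/=.
have : \sum_(y <- rem e s) signed_sqrt y a <= \sum_(y <- rem e s) signed_sqrt y b.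
  by apply: ler_sum => y _; exact: signed_sqrt_homo.
have := signed_sqrt_incr aeb; lra.
Qed.

(* An additive function of the rectangle. It dominates the area, as bisection
   requires at points of differentiability, and the side of every square meeting
   [E], where mere continuity is assumed. *)
Definition box_weight E a b c d :=
  (weight (map (@complex.Re R) E) b - weight (map (@complex.Re R) E) a) *
  (weight (map (@complex.Im R) E) d - weight (map (@complex.Im R) E) c).

Lemma box_weight_area E a b c d : a <= b -> c <= d ->
  (b - a) * (d - c) <= box_weight E a b c d.
Proof.
by move=> ab cd; apply: ler_pM; rewrite ?subr_ge0//; exact: weight_incr.
Qed.

(** Each factor grows by at least the square root of [l], through its summand at [e]. The area,
    quadratic in [l], could not absorb the linear error left by mere continuity. *)
Lemma box_weight_side E e a c l : e \in E -> a <= complex.Re e <= a + l ->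
  c <= complex.Im e <= c + l -> l <= box_weight E a (a + l) c (c + l).
Proof.
move=> eE ea ec; have l0 : 0 <= l by case/andP: ea; lra.
rewrite -[leLHS]sqr_sqrtr// expr2; apply: ler_pM; rewrite ?sqrtr_ge0//.
- have := weight_incr_sqrt (map_f (@complex.Re R) eE) ea.
  by rewrite addrAC subrr add0r.
- have := weight_incr_sqrt (map_f (@complex.Im R) eE) ec.
  by rewrite addrAC subrr add0r.
Qed.

Section Bisection.
Variables (h : R[i] -> R[i]) (E : seq R[i]).
Hypothesis ch : forall z, ccont h z.
Hypothesis dh : forall z, z \notin E -> cderivable h z.

Let heavy (eta l : R) (p : R * R) :=
  eta * box_weight E p.1 (p.1 + l) p.2 (p.2 + l) <
    `|box_int h p.1 (p.1 + l) p.2 (p.2 + l)|.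

(** Both sides of the inequality defining [heavy] come from additive functions of the rectangle, so
    four light quarters would make the whole square light. *)
Let heavy_quarter eta l p : 0 <= l -> heavy eta l p ->
  exists p', [/\ heavy eta (l / 2) p',
    p.1 <= p'.1, p'.1 + l / 2 <= p.1 + l,
    p.2 <= p'.2 & p'.2 + l / 2 <= p.2 + l].
Proof.
case: p => a c l0; rewrite /heavy/= => H; apply: contrapT => nH.
have quarter a' c' : a <= a' -> a' + l / 2 <= a + l -> c <= c' ->
    c' + l / 2 <= c + l ->
  `|box_int h a' (a' + l / 2) c' (c' + l / 2)| <=
    eta * box_weight E a' (a' + l / 2) c' (c' + l / 2).
  move=> h1 h2 h3 h4; rewrite leNgt; apply/negP => h5; apply: nH.
  by exists (a', c').
move: H; rewrite ltNge => /negP; apply.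
have p1 : a <= a by [].
have p2 : a + l / 2 <= a + l by lra.
have p3 : c <= c by [].
have p4 : c + l / 2 <= c + l by lra.
have p5 : a <= a + l / 2 by lra.
have p6 : c <= c + l / 2 by lra.
rewrite (box_int_splitx ch _ _ p5 p2).
rewrite (box_int_splity ch a (a + l / 2) p6 p4).
rewrite (box_int_splity ch (a + l / 2) (a + l) p6 p4).
have -> : box_weight E a (a + l) c (c + l) =
    box_weight E a (a + l / 2) c (c + l / 2) +
    box_weight E a (a + l / 2) (c + l / 2) (c + l) +
    (box_weight E (a + l / 2) (a + l) c (c + l / 2) +
     box_weight E (a + l / 2) (a + l) (c + l / 2) (c + l)).
  rewrite /box_weight; ring.
have := quarter a c; have := quarter a (c + l / 2).
have := quarter (a + l / 2) c; have := quarter (a + l / 2) (c + l / 2).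
have -> : a + l / 2 + l / 2 = a + l by lra.
have -> : c + l / 2 + l / 2 = c + l by lra.
move=> /(_ p5 (lexx _) p6 (lexx _)) q1 /(_ p5 (lexx _) p3 p4) q2.
move=> /(_ p1 p2 p6 (lexx _)) q3 /(_ p1 p2 p3 p4) q4.
rewrite !mulrDr.
apply: (le_trans (ler_normD _ _)); apply: lerD => //.
Show. apply: (le_trans (ler_normD _ _)); apply: lerD => //.
by apply: (le_trans (ler_normD _ _)); apply: lerD.
Qed.

(** Comparing [h] with a constant at a point of [E], and with its tangent elsewhere, leaves an error
    linear, respectively quadratic, in [l]; the matching lower bound on [box_weight] absorbs it. *)
Let light_small eta z : 0 < eta -> exists2 dl, 0 < dl & forall l a c,
  0 <= l -> l < dl -> a <= complex.Re z <= a + l -> c <= complex.Im z <= c + l ->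
  `|box_int h a (a + l) c (c + l)| <= eta * box_weight E a (a + l) c (c + l).
Proof.
move=> eta0.
have near_z dl l a c x y : l < dl / 2 -> a <= complex.Re z <= a + l ->
    c <= complex.Im z <= c + l -> a <= x <= a + l -> c <= y <= c + l ->
    normc ((x +i* y) - z) <= 2 * l /\ normc ((x +i* y) - z) < dl.
  move=> ldl za zc xa yc.
  have : normc ((x +i* y) - z) <= 2 * l.
    apply: le_trans (normc_le_ReIm _) _; rewrite ReB ImB /=.
    have : `|x - complex.Re z| <= l by rewrite ler_norml; lra.
    have : `|y - complex.Im z| <= l by rewrite ler_norml; lra.
    lra.
  move=> H; split=> //; apply: le_lt_trans H _; lra.
have [zE|zE] := boolP (z \in E).
  (* The affine estimate then gives [2 * (eta / 4) * (2 * l) = eta * l]. *)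
  have [dl dl0 hdl] := ch z (divr_gt0 eta0 (ltr0Sn R 3)).
  exists (dl / 2); first lra.
  move=> l a c l0 ldl za zc.
  apply: le_trans (@box_int_affine_approx _ _ ch _ _ _ _ (h z) 0 (eta / 4) _ _ _) _.
  - lra.
  - lra.
  - move=> x y xa yc; rewrite mul0r addr0; apply: hdl.
    by have [] := near_z _ _ _ _ _ _ ldl za zc xa yc.
  - have := box_weight_side zE za zc; nra.
(* All points of the square are within [2 * l] of [z], and [2 * (eta / 8 * (2 * l)) * (2 * l) = eta
   * l ^+ 2]. *)
have [l' /(_ _ (divr_gt0 eta0 (ltr0Sn R 7))) [dl dl0 hdl]] := dh zE.
exists (dl / 2); first lra.
move=> l a c l0 ldl za zc.
apply: le_trans (@box_int_affine_approx _ _ ch _ _ _ _ (h z - l' * z) l'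
  (eta / 8 * (2 * l)) _ _ _) _.
- lra.
- lra.
- move=> x y xa yc; have [n1 n2] := near_z _ _ _ _ _ _ ldl za zc xa yc.
  have -> : h (x +i* y) - (h z - l' * z + l' * (x +i* y)) =
    h (x +i* y) - h z - l' * ((x +i* y) - z) by ring.
  apply: le_trans (hdl _ n2) _; rewrite ler_pM2l//; lra.
- have := @box_weight_area E a (a + l) c (c + l); nra.
Qed.

(** A heavy square would contain nested heavy squares shrinking to a point, against
    [light_small]. *)
Lemma box_int_eq0 a c l : 0 <= l -> box_int h a (a + l) c (c + l) = 0.
Proof.
move=> l0; apply/eqP; rewrite -normr_le0.
suff light eta : 0 < eta -> `|box_int h a (a + l) c (c + l)| <=
    eta * box_weight E a (a + l) c (c + l).
  apply/ler_addgt0Pl => e e0; rewrite addr0.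
  have W0 : 0 <= box_weight E a (a + l) c (c + l).
    apply: le_trans (box_weight_area _ _ _); try lra.
    by rewrite mulr_ge0//; lra.
  have := light (e / (1 + box_weight E a (a + l) c (c + l))).
  rewrite divr_gt0//; last lra.
  move=> /(_ isT) /le_trans; apply.
  rewrite mulrAC ler_pdivrMr ?ler_pM2l//; lra.
move=> eta0; rewrite leNgt; apply/negP => H0.
(* The implication stands under the existential quantifier so that [choice] yields a function
   defined on all squares, heavy or not. *)
have step (np : nat * (R * R)) : exists p',
    heavy eta (l / 2 ^+ np.1) np.2 -> [/\ heavy eta (l / 2 ^+ np.1.+1) p',
    np.2.1 <= p'.1, p'.1 + l / 2 ^+ np.1.+1 <= np.2.1 + l / 2 ^+ np.1,
    np.2.2 <= p'.2 & p'.2 + l / 2 ^+ np.1.+1 <= np.2.2 + l / 2 ^+ np.1].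
  case: np => n p /=; have [hp|nhp] := pselect (heavy eta (l / 2 ^+ n) p).
    have [|p' hp'] := heavy_quarter _ hp; first by rewrite divr_ge0// exprn_ge0.
    by exists p' => _; rewrite exprSr invfM mulrA.
  by exists p.
have [next hnext] := choice step.
pose s := fix s n := if n is m.+1 then next (m, s m) else (a, c).
have hs n : heavy eta (l / 2 ^+ n) (s n).
  elim: n => [|n IH]; first by rewrite expr0 divr1.
  by have [] := hnext (n, s n) IH.
have s1 n := let: And5 _ H _ _ _ := hnext (n, s n) (hs n) in H.
have s2 n := let: And5 _ _ H _ _ := hnext (n, s n) (hs n) in H.
have s3 n := let: And5 _ _ _ H _ := hnext (n, s n) (hs n) in H.
have s4 n := let: And5 _ _ _ _ H := hnext (n, s n) (hs n) in H.
have nested (u : nat -> R) : (forall n, u n <= u n.+1) ->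
    (forall n, u n.+1 + l / 2 ^+ n.+1 <= u n + l / 2 ^+ n) ->
    exists x, forall n, u n <= x <= u n + l / 2 ^+ n.
  move=> u1 u2.
  have uS n k : u n <= u (n + k)%N.
    elim: k => [|k IH]; first by rewrite addn0.
    by rewrite addnS (le_trans IH).
  have uD n k : u (n + k)%N + l / 2 ^+ (n + k) <= u n + l / 2 ^+ n.
    elim: k => [|k IH]; first by rewrite addn0.
    by rewrite addnS; exact: le_trans IH.
  have uU (n m : nat) : u m <= u n + l / 2 ^+ n.
    have [nm|/ltnW mn] := leqP n m.
      have := uD n (m - n)%N; rewrite subnKC//; apply: le_trans.
      by rewrite lerDl divr_ge0// exprn_ge0.
    have := uS m (n - m)%N; rewrite subnKC// => /le_trans; apply.
    by rewrite lerDl divr_ge0// exprn_ge0.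
  have sup_u : has_sup (range u).
    split; first by exists (u 0); exists 0%N.
    by exists (u 0 + l / 2 ^+ 0) => _ [m _ <-]; exact: uU.
  exists (sup (range u)) => n; apply/andP; split.
    by apply: sup_upper_bound => //; exists n.
  by apply: ge_sup => [|_ [m _ <-]]; [case: sup_u|exact: uU].
have [x hx] := nested (fun n => (s n).1) s1 s2.
have [y hy] := nested (fun n => (s n).2) s3 s4.
have [dl dl0 hdl] := light_small (x +i* y) eta0.
have [n hn] : exists n, l / 2 ^+ n < dl.
  exists (Num.bound (l / dl)).
  have := archi_boundP (divr_ge0 l0 (ltW dl0)).
  rewrite ltr_pdivrMr// mulrC => lt1.
  rewrite ltr_pdivrMr ?exprn_gt0//; apply: lt_le_trans lt1 _.
  rewrite ler_pM2l// -natrX ler_nat ltnW// ltn_expl//.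
have := hs n; rewrite /heavy ltNge => /negP; apply; apply: hdl => //.
by rewrite divr_ge0// exprn_ge0.
Qed.

End Bisection.
End Goursat.

(** * Complex differentiability and slopes *)

Section ComplexDerivative.
Context {R : realType}.
Implicit Types (f g : R[i] -> R[i]) (z w : R[i]).

Lemma complex_norm z : `|z| = (normc z)%:C.
Proof. by []. Qed.

Lemma complex_gt0P (e : R[i]) : 0 < e -> exists2 r : R, 0 < r & e = r%:C.
Proof.
by case: e => x y; rewrite ltcE/= => /andP[/eqP -> x0]; exists x.
Qed.

Lemma ltc_real (x y : R) : (x%:C < y%:C) = (x < y).
Proof. by rewrite ltcE/= eqxx. Qed.

Lemma lec_real (x y : R) : (x%:C <= y%:C) = (x <= y).
Proof. by rewrite lecE/= eqxx. Qed.

Lemma ccont_cst c z : ccont (fun=> c) z.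
Proof. by move=> e e0; exists 1 => // w _; rewrite subrr normc0 ltW. Qed.

Lemma ccont_id z : ccont id z.
Proof. by move=> e e0; exists e => // w /ltW. Qed.

Lemma ccontB f g z : ccont f z -> ccont g z -> ccont (fun w => f w - g w) z.
Proof.
move=> cf cg e e0; have e2 : 0 < e / 2 by rewrite divr_gt0.
have [d d0 hd] := cf _ e2; have [d' d'0 hd'] := cg _ e2.
exists (Num.min d d'); first by rewrite lt_min d0.
move=> w; rewrite lt_min => /andP[/hd wd /hd' wd'].
have -> : f w - g w - (f z - g z) = f w - f z - (g w - g z) by ring.
by apply: le_trans (normcB_le _ _) _; rewrite [e]splitr lerD.
Qed.

Lemma ccontD f g z : ccont f z -> ccont g z -> ccont (fun w => f w + g w) z.
Proof.
move=> cf cg; under eq_fun do rewrite -[g _]opprK -[- g _]sub0r.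
by apply: ccontB => //; apply: ccontB => //; exact: ccont_cst.
Qed.

Lemma ccontM f g z : ccont f z -> ccont g z -> ccont (fun w => f w * g w) z.
Proof.
move=> cf cg e e0.
pose a := normc (f z) + 1; pose b := normc (g z) + 1.
have a0 : 0 < a by rewrite ltr_wpDl ?normc_ge0.
have b0 : 0 < b by rewrite ltr_wpDl ?normc_ge0.
have [d d0 hd] := cf (e / 2 / b) (divr_gt0 (divr_gt0 e0 (ltr0Sn R 1)) b0).
have [d' d'0 hd'] := cg (e / 2 / a) (divr_gt0 (divr_gt0 e0 (ltr0Sn R 1)) a0).
have [d1 d10 hd1] := cg 1 ltr01.
exists (Num.min (Num.min d d') d1); first by rewrite !lt_min d0 d'0.
move=> w; rewrite !lt_min => /andP[/andP[/hd wd /hd' wd'] /hd1 wd1].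
have -> : f w * g w - f z * g z = (f w - f z) * g w + f z * (g w - g z) by ring.
apply: le_trans (normcD_le _ _) _; rewrite !normcM [e]splitr.
have gw : normc (g w) <= b.
  have := normcD_le (g w - g z) (g z); rewrite subrK /b; lra.
apply: lerD.
  apply: le_trans (ler_pM (normc_ge0 _) (normc_ge0 _) wd gw) _.
  by rewrite divfK// gt_eqF.
apply: le_trans (_ : a * (e / 2 / a) <= _); last by rewrite mulrC divfK// gt_eqF.
apply: ler_pM (normc_ge0 _) (normc_ge0 _) _ wd'.
by rewrite lerDl.
Qed.

Lemma ccontV f z : f z != 0 -> ccont f z -> ccont (fun w => (f w)^-1) z.
Proof.
move=> fz cf e e0; have n0 : 0 < normc (f z) by rewrite normc_gt0.
have [d d0 hd] := cf (normc (f z) / 2) (divr_gt0 n0 (ltr0Sn R 1)).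
have [d' d'0 hd'] := cf (e * (normc (f z) * (normc (f z) / 2)))
  (mulr_gt0 e0 (mulr_gt0 n0 (divr_gt0 n0 (ltr0Sn R 1)))).
exists (Num.min d d'); first by rewrite lt_min d0.
move=> w; rewrite lt_min => /andP[/hd wd /hd' wd'].
have fw2 : normc (f z) / 2 <= normc (f w).
  have := normcB_le (f w) (f w - f z); rewrite opprB addrC subrK; lra.
have fw0 : 0 < normc (f w) by apply: lt_le_trans fw2; rewrite divr_gt0.
have fw : f w != 0 by rewrite -normc_gt0.
have -> : (f w)^-1 - (f z)^-1 = (f z - f w) / (f z * f w).
  by field; rewrite fz fw.
rewrite normcM normcV normcM ler_pdivrMr ?mulr_gt0// normcC.
by apply: le_trans wd' _; rewrite ler_pM2l// ler_pM2l.
Qed.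

(** Caratheodory's form, which reduces the differentiability of products and quotients to the
    continuity of [phi]. *)
Lemma cderivable_caratheodory f z : cderivable f z <->
  exists2 phi, ccont phi z & forall w, f w = f z + (w - z) * phi w.
Proof.
split=> [[l fl]|[phi cphi fphi]].
  exists (fun w => if w == z then l else (f w - f z) / (w - z)).
    move=> e e0; have [d d0 hd] := fl e e0; exists d => // w wz.
    rewrite eqxx; have [_|wz0] := eqVneq w z; first by rewrite subrr normc0 ltW.
    have wz1 : w - z != 0 by rewrite subr_eq0.
    have wz2 : 0 < normc (w - z) by rewrite normc_gt0.
    rewrite -(ler_pM2r wz2) -normcM mulrBl divfK//; exact: hd.
  move=> w; have [->|wz] := eqVneq w z; first by rewrite subrr mul0r addr0.
  by rewrite mulrC divfK ?subr_eq0// addrC subrK.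
exists (phi z) => e e0; have [d d0 hd] := cphi e e0; exists d => // w wz.
rewrite (fphi w).
have -> : f z + (w - z) * phi w - f z - phi z * (w - z) =
  (phi w - phi z) * (w - z) by ring.
rewrite normcM.
by rewrite ler_wpM2r ?normc_ge0//; exact: hd.
Qed.

Lemma cderivable_ccont f z : cderivable f z -> ccont f z.
Proof.
move=> /cderivable_caratheodory[phi cphi fphi].
rewrite (funext fphi); apply: ccontD; first exact: ccont_cst.
by apply: ccontM => //; apply: ccontB; [exact: ccont_id|exact: ccont_cst].
Qed.

Lemma cderivableM f g z : cderivable f z -> cderivable g z ->
  cderivable (fun w => f w * g w) z.
Proof.
move=> df; have cf := cderivable_ccont df; move: df.
move=> /cderivable_caratheodory[phi cphi fphi].
move=> /cderivable_caratheodory[psi cpsi gpsi].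
apply/cderivable_caratheodory.
exists (fun w => phi w * g z + f w * psi w).
  by apply: ccontD; apply: ccontM => //; exact: ccont_cst.
by move=> w; rewrite gpsi mulrDr {1}fphi; ring.
Qed.

Lemma cderivable_cst c z : cderivable (fun=> c) z.
Proof.
apply/cderivable_caratheodory; exists (fun=> 0); first exact: ccont_cst.
by move=> w; rewrite mulr0 addr0.
Qed.

Lemma cderivableX f n z : cderivable f z -> cderivable (fun w => f w ^+ n) z.
Proof.
move=> df; elim: n => [|n IH]; first exact: cderivable_cst.
by under eq_fun do rewrite exprS; exact: cderivableM.
Qed.

Lemma ccontX f n z : ccont f z -> ccont (fun w => f w ^+ n) z.
Proof.
move=> df; elim: n => [|n IH]; first exact: ccont_cst.
by under eq_fun do rewrite exprS; exact: ccontM.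
Qed.

Lemma cderivable_near f g z (d : R) : 0 < d ->
  (forall w, normc (w - z) < d -> f w = g w) -> cderivable f z -> cderivable g z.
Proof.
move=> d0 fg [l fl]; exists l => e e0; have [d' d'0 hd] := fl e e0.
exists (Num.min d d'); first by rewrite lt_min d0.
move=> w; rewrite lt_min => /andP[wd wd'].
by rewrite -!fg ?subrr ?normc0//; exact: hd.
Qed.

Lemma ccont_near f g z (d : R) : 0 < d ->
  (forall w, normc (w - z) < d -> f w = g w) -> ccont f z -> ccont g z.
Proof.
move=> d0 fg cf e e0; have [d' d'0 hd] := cf e e0.
exists (Num.min d d'); first by rewrite lt_min d0.
move=> w; rewrite lt_min => /andP[wd wd'].
by rewrite -!fg ?subrr ?normc0//; exact: hd.
Qed.

(* The value at [x] is the derivative, when it exists. *)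
Definition slope g x z : R[i] :=
  if z == x then xget 0 (cderiv g x) else (g z - g x) / (z - x).

Lemma slopeE g x z : g z = g x + (z - x) * slope g x z.
Proof.
rewrite /slope; have [->|zx] := eqVneq z x; first by rewrite subrr mul0r addr0.
by rewrite mulrC divfK ?subr_eq0// addrC subrK.
Qed.

Lemma ccont_slope g x : (forall z, ccont g z) -> cderivable g x ->
  forall z, ccont (slope g x) z.
Proof.
move=> cg [l0 gl0] z; have [->|zx] := eqVneq z x.
  have gl := xgetPex 0 (ex_intro _ l0 gl0 : exists l, cderiv g x l).
  move=> e e0; have [d d0 hd] := gl e e0; exists d => // w wz.
  rewrite /slope eqxx; have [_|wz0] := eqVneq w x; first by rewrite subrr normc0 ltW.
  have wz1 : w - x != 0 by rewrite subr_eq0.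
  have wz2 : 0 < normc (w - x) by rewrite normc_gt0.
  rewrite -(ler_pM2r wz2) -normcM mulrBl divfK//; exact: hd.
have zx0 : 0 < normc (z - x) by rewrite normc_gt0 subr_eq0.
apply: (@ccont_near (fun z => (g z - g x) / (z - x)) _ z _ zx0).
  move=> w wz; rewrite /slope; case: eqVneq wz => // ->.
  by rewrite normcC ltxx.
apply: ccontM; first by apply: ccontB => //; exact: ccont_cst.
apply: ccontV; first by rewrite subr_eq0.
by apply: ccontB; [exact: ccont_id|exact: ccont_cst].
Qed.

Lemma cderivable_slope g x z : z != x -> cderivable g z ->
  cderivable (slope g x) z.
Proof.
move=> zx dg; have zx0 : 0 < normc (z - x) by rewrite normc_gt0 subr_eq0.
apply: (@cderivable_near (fun z => (g z - g x) / (z - x)) _ z _ zx0).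
  move=> w wz; rewrite /slope; case: eqVneq wz => // ->.
  by rewrite normcC ltxx.
apply: cderivableM.
  move: dg => /cderivable_caratheodory[phi cphi gphi].
  by apply/cderivable_caratheodory; exists phi => // w; rewrite gphi; ring.
have zx1 : z - x != 0 by rewrite subr_eq0.
(* The inverse of [w - x] is written as its value at [z] plus a multiple of [w - z], as
   Caratheodory's form requires. *)
apply: (@cderivable_near (fun w => (z - x)^-1 - (w - z) / ((z - x) * (w - x)))
  _ z _ zx0).
  move=> w wz; have wx : w - x != 0.
    by rewrite subr_eq0; apply: contraTneq wz => ->; rewrite normcC ltxx.
  by field; rewrite zx1 wx.
apply/cderivable_caratheodory; exists (fun w => 0 - ((z - x) * (w - x))^-1).
  apply: ccontB; first exact: ccont_cst.
  apply: ccontV; first by rewrite mulf_neq0.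
  apply: ccontM; first exact: ccont_cst.
  by apply: ccontB; [exact: ccont_id|exact: ccont_cst].
by move=> w; ring.
Qed.

Lemma derivable_cderivable f z :
  derivable (f : R[i]^o -> R[i]^o) z 1 -> cderivable f z.
Proof.
pose q (h : R[i]^o) : R[i]^o := h^-1 *: (f (h *: (1 : R[i]^o) + z) - f z).
move=> /cvg_ex[l].
move=> /(@cvgrPdist_le _ _ _ (dnbhs (0 : R[i]^o)) _ q (l : R[i]^o)) fl.
exists l => e e0.
have /fl/nbhs_ballP[d /= /complex_gt0P[r r0 ->] hd] : 0 < e%:C by rewrite ltc_real.
exists r => // w wz; have [->|wz0] := eqVneq w z.
  by rewrite !subrr mulr0 subr0 normc0 mulr0.
have h0 : w - z != 0 by rewrite subr_eq0.
have := hd (w - z); rewrite -ball_normE /= sub0r normrN complex_norm ltc_real.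
move=> /(_ wz h0); rewrite complex_norm lec_real normcC /q /GRing.scale /= mulr1 subrK.
have wz2 : 0 < normc (w - z) by rewrite normc_gt0.
rewrite -(ler_pM2r wz2) -normcM mulrBl [_^-1 * _]mulrC divfK//.
by rewrite (normcC z) (normcC (l * _)).
Qed.

End ComplexDerivative.

(** * Maximum modulus principle on squares *)

Section MaximumModulus.
Context {R : realType}.
Implicit Types (f g : R[i] -> R[i]) (z w : R[i]).

(** A class stable under [slope] at a point outside [E], which then joins [E]; this is what allows
    divided differences to be iterated. *)
Definition holo_off (E : seq R[i]) g :=
  (forall z, ccont g z) /\ (forall z, z \notin E -> cderivable g z).

Lemma holo_off_slope E g x : holo_off E g -> x \notin E ->
  holo_off (x :: E) (slope g x).
Proof.
move=> [cg dg] xE; split; first by apply: ccont_slope => //; exact: dg.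
move=> z; rewrite inE negb_or => /andP[zx zE].
by apply: cderivable_slope => //; exact: dg.
Qed.

Lemma holo_offX E g n : holo_off E g -> holo_off E (fun z => g z ^+ n).
Proof.
by move=> [cg dg]; split=> z ?; [exact: ccontX|apply: cderivableX; exact: dg].
Qed.

Lemma holo_offZ E g c : holo_off E g -> holo_off E (fun z => c * g z).
Proof.
move=> [cg dg]; split=> z ?; first by apply: ccontM => //; exact: ccont_cst.
by apply: cderivableM; [exact: cderivable_cst|exact: dg].
Qed.

Definition in_square (p r : R) (z : R[i]) :=
  p - r <= complex.Re z <= p + r /\ - r <= complex.Im z <= r.

Definition on_square (p r : R) (z : R[i]) :=
  in_square p r z /\
  (complex.Re z = p - r \/ complex.Re z = p + r \/
   complex.Im z = - r \/ complex.Im z = r).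

Lemma square_dist p r z : in_square p r z -> normc (z - p%:C) <= 2 * r.
Proof.
move=> [hz1 hz2]; apply: le_trans (normc_le_ReIm _) _; rewrite ReB ImB /=.
have : `|complex.Re z - p| <= r by rewrite ler_norml; lra.
have : `|complex.Im z - 0| <= r by rewrite ler_norml; lra.
lra.
Qed.

Lemma square_sep p r z w : on_square p r z -> in_square p r w ->
  let m := Num.min (Num.min (complex.Re w - (p - r)) (p + r - complex.Re w))
                   (Num.min (complex.Im w + r) (r - complex.Im w)) in
  m <= normc (z - w).
Proof.
move=> [_ hz] [hw1 hw2] /=.
have h1 := Re_le_normc (z - w); have h2 := Im_le_normc (z - w).
rewrite ReB in h1; rewrite ImB in h2.
case: hz => [|[|[|]]] hz; rewrite !ge_min.
- have := ler_norm (- (complex.Re z - complex.Re w)); rewrite normrN hz => h3.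
  by apply/orP; left; apply/orP; left; rewrite hz in h1; lra.
- have := ler_norm (complex.Re z - complex.Re w); rewrite hz => h3.
  by apply/orP; left; apply/orP; right; rewrite hz in h1; lra.
- have := ler_norm (- (complex.Im z - complex.Im w)); rewrite normrN hz => h3.
  by apply/orP; right; apply/orP; left; rewrite hz in h2; lra.
- have := ler_norm (complex.Im z - complex.Im w); rewrite hz => h3.
  by apply/orP; right; apply/orP; right; rewrite hz in h2; lra.
Qed.

Lemma ReV z : complex.Re z^-1 = complex.Re z / normc z ^+ 2.
Proof. by case: z => x y; rewrite /= sqr_sqrtr// addr_ge0// sqr_ge0. Qed.

Lemma ImV z : complex.Im z^-1 = - complex.Im z / normc z ^+ 2.
Proof. by case: z => x y; rewrite /= sqr_sqrtr ?mulNr// addr_ge0// sqr_ge0. Qed.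

(* Each of the four integrands of the contour integral of [(g - g z) / (w - z)]
   is at most [B / m - g z * m / (4 r) ^+ 2], where [z] is at distance at least [m]
   from the boundary, and the integral vanishes. *)
Lemma square_cauchy_estimate p r (g : R[i] -> R[i]) E z (t m B : R) :
  0 < r -> holo_off E g -> z \notin E -> 0 < m ->
  p - r + m <= complex.Re z <= p + r - m -> - r + m <= complex.Im z <= r - m ->
  g z = t%:C -> 0 <= t -> (forall w, on_square p r w -> normc (g w) <= B) ->
  t <= B / m * ((4 * r) ^+ 2 / m).
Proof.
move=> r0 hg zE m0 zre zim gz t0 gB.
have [ch dh] := holo_off_slope hg zE.
set h := slope g z in ch dh.
pose v := B / m - t * (m / (4 * r) ^+ 2).
have zin : in_square p r z by split; lra.
have bnd w : on_square p r w ->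
    [/\ normc (w - z) <= 4 * r, m <= normc (w - z), 0 <= B & h w = (g w - t%:C) / (w - z)].
  move=> wo.
  have mz : m <= normc (w - z).
    apply: le_trans (square_sep wo zin); rewrite !le_min.
    by apply/andP; split; apply/andP; split; lra.
  split=> //.
  - have -> : w - z = w - p%:C - (z - p%:C) by ring.
    apply: le_trans (normcB_le _ _) _.
    have := square_dist zin; have := square_dist wo.1; lra.
  - exact: le_trans (normc_ge0 _) (gB _ wo).
  - rewrite /h /slope gz; case: eqVneq => // wz.
    by move: mz; rewrite wz subrr normc0 leNgt m0.
have term1 w : on_square p r w -> normc (g w / (w - z)) <= B / m.
  move=> wo; have [_ mw B0 _] := bnd w wo.
  rewrite normcM normcV ler_pM ?normc_ge0// ?invr_ge0 ?normc_ge0//; first exact: gB.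
  by rewrite lef_pV2// posrE// (lt_le_trans m0).
have term2 w x : on_square p r w -> m <= x ->
    t * (m / (4 * r) ^+ 2) <= t * (x / normc (w - z) ^+ 2).
  move=> wo mx; have [w4 mw _ _] := bnd w wo.
  have nw0 : 0 < normc (w - z) by exact: lt_le_trans mw.
  apply: ler_wpM2l => //; apply: ler_pM => //; first exact: ltW.
    by rewrite invr_ge0 sqr_ge0.
  rewrite lef_pV2 ?posrE ?exprn_gt0//; last lra.
  by rewrite lerXn2r// ?nnegrE ?normc_ge0//; lra.
have RehM w : on_square p r w -> complex.Re (h w) =
    complex.Re (g w / (w - z)) - t * (complex.Re (w - z) / normc (w - z) ^+ 2).
  move=> wo; have [_ _ _ ->] := bnd w wo.
  by rewrite -ReV mulrBl ReB; case: (_^-1) => ? ? /=; rewrite mul0r subr0.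
have ImhM w : on_square p r w -> complex.Im (h w) =
    complex.Im (g w / (w - z)) + t * (complex.Im (w - z) / normc (w - z) ^+ 2).
  move=> wo; have [_ _ _ ->] := bnd w wo.
  have := ImV (w - z); rewrite mulNr => /(congr1 -%R); rewrite opprK => <-.
  by rewrite mulrBl ImB; case: (_^-1) => ? ? /=; rewrite mul0r addr0 mulrN.
have rr : p + r = p - r + (2 * r) by ring.
have rr' : r = - r + (2 * r) by ring.
have J0 : box_int h (p - r) (p + r) (- r) r = 0.
  have r2 : 0 <= 2 * r by lra.
  by have := box_int_eq0 ch dh (p - r) (- r) r2; rewrite -rr -rr'.
have o1 y : - r <= y <= r -> on_square p r ((p + r) +i* y).
  by move=> hy; split; [split=> /=; lra|right; left].
have o2 y : - r <= y <= r -> on_square p r ((p - r) +i* y).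
  by move=> hy; split; [split=> /=; lra|left].
have o3 x : p - r <= x <= p + r -> on_square p r (x +i* r).
  by move=> hx; split; [split=> /=; lra|right; right; right].
have o4 x : p - r <= x <= p + r -> on_square p r (x +i* (- r)).
  by move=> hx; split; [split=> /=; lra|right; right; left].
have I1 : seg_int (- r) r (fun y => complex.Re (h ((p + r) +i* y)) -
    complex.Re (h ((p - r) +i* y))) <= 2 * v * (r - - r).
  have rr2 : - r <= r by lra.
  apply: (seg_int_le (@continuous_Re_diff _ _ ch _ _) rr2).
  move=> y hy; have O1 := o1 y hy; have O2 := o2 y hy.
  rewrite !RehM// !ReB /=.
  have := term2 _ (p + r - complex.Re z) O1; have := term2 _ (complex.Re z - (p - r)) O2.
  have := le_trans (ler_norm _) (le_trans (Re_le_normc _) (term1 _ O1)).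
  have := ler_norm (- complex.Re (g ((p - r) +i* y) / ((p - r) +i* y - z))).
  rewrite normrN => /le_trans/(_ (le_trans (Re_le_normc _) (term1 _ O2))).
  rewrite -[p - r - complex.Re z]opprB mulNr mulrN opprK /v.
  lra.
have I2 : - (2 * v) * (p + r - (p - r)) <= seg_int (p - r) (p + r)
    (fun x => complex.Im (h (x +i* r)) - complex.Im (h (x +i* (- r)))).
  have pr2 : p - r <= p + r by lra.
  apply: (seg_int_ge (@continuous_Im_diff _ _ ch _ _) pr2).
  move=> x hx; have O1 := o3 x hx; have O2 := o4 x hx.
  rewrite !ImhM// !ImB /=.
  have := term2 _ (r - complex.Im z) O1; have := term2 _ (complex.Im z + r) O2.
  have := le_trans (ler_norm _) (le_trans (Im_le_normc _) (term1 _ O2)).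
  have := ler_norm (- complex.Im (g (x +i* r) / (x +i* r - z))).
  rewrite normrN => /le_trans/(_ (le_trans (Im_le_normc _) (term1 _ O1))).
  have -> : - r - complex.Im z = - (complex.Im z + r) by ring.
  rewrite mulNr mulrN /v.
  lra.
have : 0 <= v.
  move: J0; rewrite /box_int; set i1 := seg_int _ _ _; set i2 := seg_int _ _ _.
  by move: I1 I2; rewrite -/i1 -/i2; clearbody i1 i2 v => *; nra.
rewrite /v subr_ge0 -ler_pdivlMr ?divr_gt0 ?exprn_gt0//; last lra.
by rewrite invf_div.
Qed.

(** By Bernoulli's inequality the powers of a number above 1 grow at least linearly. *)
Lemma expn_bounded_le1 (x C : R) : (forall n, x ^+ n <= C) -> x <= 1.
Proof.
move=> xC; rewrite leNgt; apply/negP => x1.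
have ber n : 1 + n%:R * (x - 1) <= x ^+ n.
  elim: n => [|n IH]; first by rewrite mul0r addr0.
  rewrite exprS -natr1; have n0 : 0 <= n%:R :> R by [].
  have x0 : 0 <= x by lra.
  have := ler_wpM2l x0 IH; have := mulr_ge0 n0 (sqr_ge0 (x - 1)).
  rewrite expr2; lra.
have := archi_boundP (_ : 0 <= `|C| / (x - 1)).
rewrite divr_ge0//; last lra.
move=> /(_ isT); rewrite ltr_pdivrMr ?subr_gt0// => h.
have := ber (Num.bound (`|C| / (x - 1))); have := xC (Num.bound (`|C| / (x - 1))).
have := ler_norm C; lra.
Qed.

(* Landau's trick: the Cauchy estimate with an unspecified constant, applied to
   all the powers of [g], yields the constant 1. *)
Lemma maximum_modulus p r g E z B : 0 < r -> holo_off E g -> z \notin E ->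
  in_square p r z -> (forall w, on_square p r w -> normc (g w) <= B) ->
  normc (g z) <= B.
Proof.
move=> r0 hg zE zin gB.
have [zo|zo] := pselect (on_square p r z); first exact: gB.
pose m := Num.min (Num.min (complex.Re z - (p - r)) (p + r - complex.Re z))
  (Num.min (complex.Im z + r) (r - complex.Im z)).
have [h1 h2] := zin.
have m0 : 0 < m.
  rewrite !lt_min; have [h3 h4] := (andP h1); have [h5 h6] := (andP h2).
  apply/andP; split; apply/andP; split.
  - rewrite subr_gt0 lt_neqAle h3 andbT; apply/eqP => H.
    by apply: zo; split=> //; left.
  - rewrite subr_gt0 lt_neqAle h4 andbT; apply/eqP => H.
    by apply: zo; split=> //; right; left.
  - rewrite -[r]opprK subr_gt0 lt_neqAle h5 andbT; apply/eqP => H.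
    by apply: zo; split=> //; right; right; left.
  - rewrite subr_gt0 lt_neqAle h6 andbT; apply/eqP => H.
    by apply: zo; split=> //; right; right; right.
have mle x : x \in [:: complex.Re z - (p - r); p + r - complex.Re z;
    complex.Im z + r; r - complex.Im z] -> m <= x.
  rewrite /m !inE => /or4P[] /eqP ->; rewrite !ge_min lexx ?orbT //.
have m1 := mle _ (mem_head _ _).
have m2 : m <= p + r - complex.Re z by apply: mle; rewrite !inE eqxx ?orbT.
have m3 : m <= complex.Im z + r by apply: mle; rewrite !inE eqxx ?orbT.
have m4 : m <= r - complex.Im z by apply: mle; rewrite !inE eqxx ?orbT.
have B0 : 0 <= B.
  apply: le_trans (normc_ge0 _) (gB ((p + r) +i* 0) _).
  by split; [split=> /=; lra|right; left].
pose C := m^-1 * ((4 * r) ^+ 2 / m).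
have C0 : 0 <= C by rewrite mulr_ge0 ?invr_ge0 ?divr_ge0 ?sqr_ge0// ltW.
have est n : normc (g z) ^+ n <= B ^+ n * C.
  rewrite -normcX; set a := g z ^+ n.
  have [->|a0] := eqVneq a 0.
    by rewrite normc0 mulr_ge0 ?exprn_ge0.
  have na0 : normc a != 0 by rewrite normc_eq0.
  (* Rotation by [u] makes the value at [z] a nonnegative real, as the Cauchy estimate demands. *)
  pose u := (normc a)%:C / a.
  have nu : normc u = 1.
    by rewrite normcM normcV normcR ger0_norm ?normc_ge0// divff.
  rewrite /C mulrA.
  apply: (@square_cauchy_estimate p r (fun w => u * g w ^+ n) E z (normc a) m
    (B ^+ n) r0 (holo_offZ u (holo_offX n hg)) zE m0).
  - lra.
  - lra.
  - by rewrite -/a /u divfK.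
  - exact: normc_ge0.
  move=> w wo; rewrite normcM nu mul1r normcX lerXn2r ?nnegrE ?normc_ge0//.
  exact: gB.
(* The powers of [normc (g z) / B] are bounded by [C] when [B] is nonzero; otherwise the estimate
   for the first power is enough. *)
have [B0'|Bn0] := eqVneq B 0.
  by have := est 1; rewrite B0' !expr1 mul0r.
have Bp : 0 < B by rewrite lt_def Bn0.
rewrite -[leRHS]mul1r -ler_pdivrMr//; apply: (@expn_bounded_le1 _ C) => n.
by rewrite exprMn exprVn ler_pdivrMr ?exprn_gt0// mulrC.
Qed.

End MaximumModulus.

(** * Divided differences and Newton interpolation *)

Section DividedDifferences.
Context {R : realType}.
Implicit Types (f g : R[i] -> R[i]) (z w : R[i]).

(** The divided difference of [f] at the nodes [x 0, ..., x (k - 1)] and [z]. Its last node stays a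
    variable so that it can be bounded on a whole square. *)
Fixpoint ddiff (x : nat -> R[i]) f k : R[i] -> R[i] :=
  if k is k'.+1 then slope (ddiff x f k') (x k') else f.

Lemma newton_interpolation (x : nat -> R[i]) f m z :
  f z = \sum_(k < m) (\prod_(i < k) (z - x i)) * ddiff x f k (x k) +
        (\prod_(i < m) (z - x i)) * ddiff x f m z.
Proof.
elim: m => [|m IH]; first by rewrite big_ord0 big_ord0 mul1r add0r.
by rewrite IH big_ord_recr [in RHS]big_ord_recr/= (slopeE _ (x m) z); ring.
Qed.

(** On the boundary every node is at distance at least [r - 2 >= r / 2], so a slope is at most twice
    the previous bound divided by [r / 2], which is the factor [4 / r]. The maximum principle
    carries this inside, in particular to the next node. *)
Lemma ddiff_bound (p r B : R) (x : nat -> R) n f : 4 <= r ->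
  (forall z, cderivable f z) -> (forall i, (i < n)%N -> `|x i - p| <= 2) ->
  (forall i j, (i < n)%N -> (j < n)%N -> x i = x j -> i = j) ->
  (forall z, in_square p r z -> normc (f z) <= B) ->
  forall k z, (k <= n)%N -> in_square p r z ->
    (forall i, (i < k)%N -> z != (x i)%:C) ->
    normc (ddiff (fun i => (x i)%:C) f k z) <= (4 / r) ^+ k * B.
Proof.
move=> r4 df xp xinj fB k.
have xin i : (i < n)%N -> in_square p r (x i)%:C.
  by move=> /xp; rewrite ler_norml => h; split=> /=; lra.
(* [E] lists nodes already used; there continuity is established, and differentiability
   elsewhere. *)
suff [E [hE Ek bnd]] : exists E, [/\ (k <= n)%N ->
    holo_off E (ddiff (fun i => (x i)%:C) f k),
    forall z, z \in E -> exists2 i, (i < k)%N & z = (x i)%:C &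
    (k <= n)%N -> forall z, in_square p r z -> z \notin E ->
    normc (ddiff (fun i => (x i)%:C) f k z) <= (4 / r) ^+ k * B].
  move=> z kn zin zx; apply: bnd => //; apply/negP => /Ek[i ik zi].
  by move: (zx i ik); rewrite zi eqxx.
elim: k => [|k [E [hE Ek bnd]]].
  exists [::]; split=> //.
  - by move=> _; split=> [z|z _] //=; exact: cderivable_ccont.
  - by move=> _ z zin _; rewrite expr0 mul1r; exact: fB.
have xkE : (k < n)%N -> (x k)%:C \notin E.
  move=> kn; apply/negP => /Ek[i ik [/xinj xki]].
  by have ki := xki kn (ltn_trans ik kn); rewrite ki ltnn in ik.
exists ((x k)%:C :: E); split.
- by move=> kn; apply: holo_off_slope; [apply/hE/ltnW|exact: xkE].
- move=> z; rewrite inE => /orP[/eqP->|/Ek[i ik ->]]; first by exists k.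
  by exists i => //; exact: leq_trans ik _.
move=> kn z zin zE.
have hk := holo_off_slope (hE (ltnW kn)) (xkE kn).
apply: (maximum_modulus _ hk zE zin); first lra.
move=> w wo.
have sep i : (i < n)%N -> r / 2 <= normc (w - (x i)%:C).
  move=> ni; apply: le_trans (square_sep wo (xin i ni)); rewrite !le_min /=.
  have := xp i ni; rewrite ler_norml => h.
  by apply/andP; split; apply/andP; split; lra.
have wE : w \notin E.
  apply/negP => /Ek[i ik wi]; have := sep i (ltn_trans ik kn).
  by rewrite wi subrr normc0; lra.
have w0 : 0 < normc (w - (x k)%:C) by apply: lt_le_trans (sep k kn); lra.
rewrite /slope ifN; last by rewrite -subr_eq0 -normc_gt0.
have h1 := bnd (ltnW kn) w wo.1 wE.
have h2 := bnd (ltnW kn) _ (xin k kn) (xkE kn).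
have h3 := normcB_le (ddiff (fun i => (x i)%:C) f k w)
  (ddiff (fun i => (x i)%:C) f k (x k)%:C).
rewrite normcM normcV ler_pdivrMr//.
apply: le_trans h3 _; apply: le_trans (lerD h1 h2) _.
have -> : (4 / r) ^+ k.+1 * B = ((4 / r) ^+ k * B) * (4 / r).
  by rewrite exprS; ring.
set T := (4 / r) ^+ k * B in h1 *.
have T0 : 0 <= T by exact: le_trans (normc_ge0 _) h1.
have -> : T + T = T * (4 / r) * (r / 2) by field; lra.
apply: ler_wpM2l (sep k kn); rewrite mulr_ge0 ?divr_ge0//; lra.
Qed.

Lemma ddiff_growth (A M sigma p : R) (x : nat -> R) n f k :
  0 < A -> 0 < M -> 0 < sigma ->
  (forall z, cderivable f z) -> (forall i, (i < n)%N -> `|x i - p| <= 2) ->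
  (forall i j, (i < n)%N -> (j < n)%N -> x i = x j -> i = j) ->
  (forall z, normc (f z) <= A * expR (M * normc (z - p%:C) `^ sigma)) ->
  (k < n)%N ->
  normc (ddiff (fun i => (x i)%:C) f k (x k)%:C) <=
    A * expR (M * 8 `^ sigma * k.+1%:R - k%:R * ln k%:R / sigma).
Proof.
move=> A0 M0 s0 df xp xinj fA kn.
have lnk0 : 0 <= ln k%:R :> R.
  by case: k {kn} => [|k]; [rewrite ln0|apply: ln_ge0; rewrite ler1n].
(* [e] is [k] to the power [1 / sigma], and 1 at [k = 0] since [ln 0 = 0], whence [k.+1] in the
   bound. The half-side [4 * e] makes the factor [4 / r] equal to the inverse of [e]; points of the
   square are within [8 * e] of [p], whence the constant 8. *)
pose e := expR (ln k%:R / sigma) : R.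
have e1 : 1 <= e by rewrite -expR0 ler_expR divr_ge0// ltW.
have ek : e `^ sigma <= k.+1%:R.
  rewrite /e -expRM divfK ?gt_eqF//; case: k {kn lnk0 e e1} => [|k].
    by rewrite ln0// expR0.
  by rewrite lnK ?posrE ?ltr0n// ler_nat.
have xk : in_square p (4 * e) (x k)%:C.
  by have := xp k kn; rewrite ler_norml => h; split=> /=; lra.
apply: le_trans (@ddiff_bound p (4 * e) (A * expR (M * 8 `^ sigma * k.+1%:R))
  x n f _ df xp xinj _ k _ (ltnW kn) xk _) _.
- lra.
- move=> z /square_dist zp; apply: le_trans (fA z) _.
  rewrite ler_pM2l// ler_expR -mulrA ler_pM2l//.
  apply: le_trans (_ : (8 * e) `^ sigma <= _).
    apply: ge0_ler_powR; rewrite ?nnegrE ?normc_ge0//; lra.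
  by rewrite powRM//; [rewrite ler_wpM2l// powR_ge0|lra].
- move=> i ik; apply/eqP => -[/(xinj _ _ kn (ltn_trans ik kn)) ki].
  by rewrite ki ltnn in ik.
have -> : 4 / (4 * e) = expR (- (ln k%:R / sigma)).
  by rewrite expRN -/e; field; lra.
rewrite -expRM_natl mulrCA -expRD.
rewrite le_eqVlt; apply/orP; left; apply/eqP; congr (_ * expR _); ring.
Qed.

Lemma normc_sum (I : Type) (r : seq I) (P : pred I) (F : I -> R[i]) :
  normc (\sum_(i <- r | P i) F i) <= \sum_(i <- r | P i) normc (F i).
Proof.
elim/big_rec2: _ => [|i y z _ zy]; first by rewrite normc0.
by apply: le_trans (normcD_le _ _) _; rewrite lerD2l.
Qed.

Lemma normc_prod (I : Type) (r : seq I) (P : pred I) (F : I -> R[i]) :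
  normc (\prod_(i <- r | P i) F i) = \prod_(i <- r | P i) normc (F i).
Proof.
elim/big_rec2: _ => [|i y z _ <-]; first by rewrite normc1.
by rewrite normcM.
Qed.

(** Leibniz expansion. The crude factor [n!] is harmless against exponents of order [n ^ 2]. *)
Lemma normc_det_le n (D : 'M[R[i]]_n) (b : 'I_n -> R) :
  (forall i j, normc (D i j) <= b i) -> normc (\det D) <= n`!%:R * \prod_i b i.
Proof.
move=> Db; apply: le_trans (normc_sum _ _ _) _.
apply: le_trans (_ : \sum_(s : 'S_n) \prod_i b i <= _).
  apply: ler_sum => s _; rewrite normcM normcX normc_opp normc1 expr1n mul1r.
  by rewrite normc_prod; apply: ler_prod => i _; rewrite normc_ge0/=.
by rewrite sumr_const card_Sn mulr_natl.
Qed.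

(* By Newton interpolation the matrix factors through the lower triangular
   matrix with diagonal entries [\prod_(k < i) (x i - x k)]. *)
Lemma normc_det_interpolation n (x : nat -> R) (f : nat -> R[i] -> R[i])
    (b : nat -> R) :
  (forall i j, (i < n)%N -> (j < n)%N -> `|x i - x j| <= 2) ->
  (forall k j, (k < n)%N -> (j < n)%N ->
     normc (ddiff (fun i => (x i)%:C) (f j) k (x k)%:C) <= b k) ->
  normc (\det (\matrix_(i < n, j < n) f j (x i)%:C)) <=
    n`!%:R * \prod_(k < n) (2 ^+ k * b k).
Proof.
move=> xx fb.
pose W : 'M[R[i]]_n := \matrix_(i < n, k < n) \prod_(l < k) ((x i)%:C - (x l)%:C).
pose D : 'M[R[i]]_n :=
  \matrix_(k < n, j < n) ddiff (fun i => (x i)%:C) (f j) k (x k)%:C.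
have -> : (\matrix_(i < n, j < n) f j (x i)%:C) = W *m D.
  apply/matrixP => i j; rewrite !mxE.
  rewrite (newton_interpolation (fun i => (x i)%:C) _ n).
  rewrite [X in _ + X * _](bigD1 i)//= subrr !mul0r addr0.
  by apply: eq_bigr => k _; rewrite !mxE.
have Wtrig : is_trig_mx W.
  apply/is_trig_mxP => i j ij; rewrite mxE (bigD1 (Ordinal ij))//=.
  by rewrite subrr mul0r.
rewrite det_mulmx normcM (det_trig Wtrig) normc_prod big_split/= mulrCA.
apply: ler_pM; rewrite ?normc_ge0//.
- by apply: prodr_ge0 => i _; exact: normc_ge0.
- apply: ler_prod => i _; rewrite normc_ge0 mxE normc_prod.
  have -> : 2 ^+ i = \prod_(l < i) (2 : R) by rewrite prodr_const card_ord.
  apply: ler_prod => l _.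
  rewrite normc_ge0 -rmorphB normcR; apply: xx => //.
  exact: ltn_trans (ltn_ord l) _.
- by apply: normc_det_le => i j; rewrite mxE; exact: fb.
Qed.

End DividedDifferences.

(** * Bounds on determinants of the kernel *)

Section KernelDeterminant.
Context {R : realType}.

(** Discrete analogue of the integral of [x * ln x]; the error [n ^ 2] is coarse enough for an
    induction using only [ln (m + 1) <= ln m + 1 / m]. *)
Lemma sum_mul_ln (n : nat) : (0 < n)%N ->
  n%:R ^+ 2 * ln n%:R / 2 - n%:R ^+ 2 <= \sum_(k < n) k%:R * ln k%:R :> R.
Proof.
elim: n => // -[_ _|n IH _].
  by rewrite big_ord1 ln1 mul0r mulr0 mul0r expr1n; lra.
rewrite big_ord_recr/=; have {}IH := IH isT.
set m := n.+1%:R in IH *; have m1 : 1 <= m :> R by rewrite ler1n.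
have -> : n.+2%:R = m + 1 :> R by rewrite /m natr1.
have l1 : ln (m + 1) <= ln m + m^-1.
  have -> : m + 1 = m * (1 + m^-1) by field; lra.
  rewrite lnM ?posrE ?addr_gt0 ?invr_gt0//; try lra.
  rewrite lerD2l; apply: le_ln1Dx.
  by apply: lt_le_trans (_ : 0 <= _) => //; rewrite invr_ge0; lra.
have l2 : ln m <= m.
  by apply/ltW/ln_sublinear; lra.
have l3 : 0 <= ln m by exact: ln_ge0.
have m0 : 0 <= (m + 1) ^+ 2 by exact: sqr_ge0.
have := ler_wpM2l m0 l1.
have -> : (m + 1) ^+ 2 * (ln m + m^-1) =
  m ^+ 2 * ln m + 2 * m * ln m + ln m + m + 2 + m^-1 by field; lra.
have : m^-1 <= 1 by rewrite invf_le1//; lra.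
move: IH; set S := \sum_(_ < _) _; clearbody m; rewrite !expr2. lra.
Qed.

(** The factors of [n!] and of [h ^+ n] are spread over the product, so that one bound for each [k]
    suffices. *)
Lemma fact_prod_le_expR (n : nat) (g t : nat -> R) (h : R) : 0 <= h ->
  (forall k, 0 <= g k) -> (forall k, k.+1%:R * g k * h <= expR (t k)) ->
  n`!%:R * (\prod_(k < n) g k) * h ^+ n <= expR (\sum_(k < n) t k).
Proof.
move=> h0 g0 gt; elim: n => [|n IH]; first by rewrite !big_ord0 fact0 expR0 !mulr1.
rewrite !big_ord_recr/= expRD factS exprSr natrM.
have -> : n.+1%:R * n`!%:R * (\prod_(k < n) g k * g n) * (h ^+ n * h) =
  n`!%:R * (\prod_(k < n) g k) * h ^+ n * (n.+1%:R * g n * h) by ring.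
by apply: ler_pM => //; rewrite ?mulr_ge0 ?exprn_ge0// prodr_ge0.
Qed.

(** The first four summands bound, per unit of [k.+1], the exponent of the [k]-th factor with the
    decay in [k * ln k] removed, and the sum of the [k.+1] is at most [n ^ 2]. The last one pays for
    the error in [sum_mul_ln]. *)
Definition det_const (A M sigma s : R) : R :=
  2 + `|ln A| + 2 * ln (Num.max 1 s) + M * 8 `^ sigma + sigma^-1.

Lemma det_bound_arith (A M sigma s : R) (n : nat) :
  0 < A -> 0 < M -> 0 < sigma -> (0 < n)%N ->
  n`!%:R * \prod_(k < n) (2 ^+ k * (A * expR (M * 8 `^ sigma * k.+1%:R -
      k%:R * ln k%:R / sigma))) * (2 * Num.max 1 s ^+ 2) ^+ n <=
  expR (det_const A M sigma s * n%:R ^+ 2 - n%:R ^+ 2 * ln n%:R / (2 * sigma)).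
Proof.
move=> A0 M0 s0 n0.
set m := M * 8 `^ sigma; set u := Num.max 1 s.
have m0 : 0 <= m by rewrite mulr_ge0 ?powR_ge0// ltW.
have u1 : 1 <= u by rewrite le_max lexx.
pose c1 := 2 + `|ln A| + 2 * ln u + m.
have lu0 : 0 <= ln u by exact: ln_ge0.
apply: le_trans (@fact_prod_le_expR n
  (fun k => 2 ^+ k * (A * expR (m * k.+1%:R - k%:R * ln k%:R / sigma)))
  (fun k => c1 * k.+1%:R - k%:R * ln k%:R / sigma) (2 * u ^+ 2) _ _ _) _.
- by rewrite mulr_ge0// sqr_ge0.
- by move=> k; rewrite mulr_ge0 ?exprn_ge0// mulr_ge0 ?expR_ge0// ltW.
- move=> k; set l := k%:R * ln k%:R / sigma.
  have e2 : 2 <= expR 1 :> R by have := @expR_ge1Dx R 1; lra.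
  have h1 : k.+1%:R <= expR k%:R :> R by have := @expR_ge1Dx R k%:R; rewrite nat1r.
  have h2 : 2 ^+ k.+1 <= expR k.+1%:R :> R.
    by rewrite -[k.+1%:R]mulr1 expRM_natl lerXn2r// nnegrE// expR_ge0.
  have h3 : A <= expR `|ln A|.
    by rewrite -[leLHS](lnK (_ : A \is Num.pos)) ?posrE// ler_expR ler_norm.
  have h4 : u ^+ 2 = expR (2 * ln u).
    by rewrite expRM_natl lnK// posrE; lra.
  have -> : k.+1%:R * (2 ^+ k * (A * expR (m * k.+1%:R - l))) * (2 * u ^+ 2) =
     k.+1%:R * 2 ^+ k.+1 * A * (expR (m * k.+1%:R - l) * u ^+ 2).
    by rewrite [2 ^+ k.+1]exprS; ring.
  apply: le_trans (_ : expR k%:R * expR k.+1%:R * expR `|ln A| *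
      (expR (m * k.+1%:R - l) * expR (2 * ln u)) <= _).
    rewrite h4; apply: ler_wpM2r; first by rewrite mulr_ge0 ?expR_ge0.
    apply: ler_pM; [by rewrite mulr_ge0 ?exprn_ge0|exact: ltW| |exact: h3].
    by apply: ler_pM; rewrite ?exprn_ge0.
  rewrite -!expRD ler_expR /c1 -natr1.
  have : 0 <= k%:R :> R by [].
  have : 0 <= `|ln A| by [].
  move: `|ln A| => a; nra.
rewrite ler_expR sumrB -mulr_sumr -mulr_suml.
have h := sum_mul_ln n0.
have hs : \sum_(k < n) k.+1%:R <= n%:R ^+ 2 :> R.
  elim: (n) => [|k IH]; first by rewrite big_ord0 sqr_ge0.
  rewrite big_ord_recr/= -[k.+1%:R]natr1 sqrrD1; have : 0 <= k%:R :> R by [].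
  lra.
have c10 : 0 <= c1 by rewrite /c1; have : 0 <= `|ln A| by []; lra.
have h5 := ler_wpM2l c10 hs.
have si0 : 0 <= sigma^-1 by rewrite invr_ge0 ltW.
have h6 := ler_wpM2r si0 h.
rewrite /det_const -/u -/m.
have -> : n%:R ^+ 2 * ln n%:R / (2 * sigma) = n%:R ^+ 2 * ln n%:R / 2 / sigma.
  by field; rewrite gt_eqF.
move: h6; rewrite mulrBl /c1; move: h5; rewrite /c1; lra.
Qed.

Lemma normc_conj (z : R[i]) : normc z^* = normc z.
Proof. by case: z => x y /=; rewrite sqrrN. Qed.

(** The factor [2 ^+ n] is the volume of the [n]-th power of an interval of length 2. *)
Lemma normc_kernel_det (A M sigma s p : R) (K : R -> R -> R[i]) (U : set R)
    (Kt : R[i] -> R[i] -> R[i]) (rho : R -> R) (n : nat) (t : n.-tuple R) :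
  0 < A -> 0 < M -> 0 < sigma -> (0 < n)%N ->
  (forall w, entire (fun z => Kt z w)) ->
  (forall z w, Kt z w = (Kt w z)^*) ->
  (forall p, U p -> 0 < rho p <= s) ->
  (forall p z, U p ->
    normc (Kt p%:C z) <= A * expR (M * normc (z - p%:C) `^ sigma)) ->
  (forall x y, U x -> U y -> K x y = (rho x * rho y)%:C * Kt x%:C y%:C) ->
  (forall i, U (tnth t i)) -> (forall i, `|tnth t i - p| <= 1) ->
  normc (\det (\matrix_(i < n, j < n) K (tnth t i) (tnth t j))) * 2 ^+ n <=
  expR (det_const A M sigma s * n%:R ^+ 2 - n%:R ^+ 2 * ln n%:R / (2 * sigma)).
Proof.
move=> A0 M0 s0 n0 Kent Ksym rhos KA KKt tU tp.
(* Interpolation wants distinct nodes; a repeated one gives two equal rows. *)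
have [/tuple_uniqP tinj|] := boolP (uniq t); last first.
  move=> /tuple_uniqP tninj.
  have [i [j [ij tij]]] : exists i j, i != j /\ tnth t i = tnth t j.
    apply: contrapT => H; apply: tninj => i j tij; apply/eqP/negPn/negP => ij.
    by apply: H; exists i, j.
  rewrite (determinant_alternate ij) => [|k]; first by rewrite normc0 mul0r expR_ge0.
  by rewrite !mxE tij.
pose x k := nth 0 t k.
have xE (i : 'I_n) : tnth t i = x i by rewrite /x -tnth_nth.
have xU i : (i < n)%N -> U (x i) by move=> ni; rewrite -(xE (Ordinal ni)).
have xx i j : (i < n)%N -> (j < n)%N -> `|x i - x j| <= 2.
  move=> ni nj; rewrite -(xE (Ordinal ni)) -(xE (Ordinal nj)).
  by have := tp (Ordinal ni); have := tp (Ordinal nj); rewrite !ler_norml; lra.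
have xinj i j : (i < n)%N -> (j < n)%N -> x i = x j -> i = j.
  move=> ni nj; rewrite -(xE (Ordinal ni)) -(xE (Ordinal nj)) => /tinj.
  by move=> /(congr1 val).
have -> : (\matrix_(i < n, j < n) K (tnth t i) (tnth t j)) =
    diag_mx (\row_i (rho (x i))%:C) *m
    (\matrix_(i < n, j < n) Kt (x i)%:C (x j)%:C) *m
    diag_mx (\row_i (rho (x i))%:C).
  apply/matrixP => i j; rewrite mul_mx_diag mxE mul_diag_mx !mxE !xE.
  rewrite KKt; [by rewrite rmorphM; ring|exact: xU|exact: xU].
rewrite !det_mulmx !normcM det_diag normc_prod.
have Prho : \prod_(i < n) normc ((\row_(i < n) (rho (x i))%:C) 0 i) <=
    Num.max 1 s ^+ n.
  have -> : Num.max 1 s ^+ n = \prod_(i < n) Num.max 1 s.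
    by rewrite prodr_const card_ord.
  apply: ler_prod => i _; rewrite normc_ge0 mxE normcR.
  have /andP[r0 rs] := rhos _ (xU i (ltn_ord i)).
  by rewrite ger0_norm ?(ltW r0)// le_max rs orbT.
have Prho0 : 0 <= \prod_(i < n) normc ((\row_(i < n) (rho (x i))%:C) 0 i).
  by apply: prodr_ge0 => i _; exact: normc_ge0.
have detKt := @normc_det_interpolation _ n x (fun j z => Kt z (x j)%:C)
  (fun k => A * expR (M * 8 `^ sigma * k.+1%:R - k%:R * ln k%:R / sigma)) xx.
apply: le_trans (det_bound_arith s A0 M0 s0 n0).
rewrite exprMn -exprM mulnC exprM expr2 [X in _ <= X]mulrCA [X in _ <= X]mulrC.
apply: ler_wpM2r; first by rewrite exprn_ge0.
rewrite mulrAC mulrC; apply: ler_pM.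
- exact: normc_ge0.
- exact: mulr_ge0.
- apply: detKt => k j kn jn.
  (* The growth is centred at the node [x j], which lies in [U], while [p] may not; the other nodes
     are within 2 of it. *)
  apply: (@ddiff_growth _ A M sigma (x j) x n _ k) => //.
  + by move=> z; apply: derivable_cderivable; exact: Kent.
  + by move=> i ni; exact: xx.
  + by move=> z; rewrite Ksym normc_conj; apply: KA; exact: xU.
- exact: ler_pM.
Qed.

End KernelDeterminant.

(** * Tails of the number of particles *)

Section NonmeasurableMonotonicity.
Local Open Scope ereal_scope.
Context d (T : measurableType d) (R : realType) (mu : {measure set T -> \bar R}).

(** The integral of a nonnegative function is the supremum over simple functions below it, hence
    monotone even on nonmeasurable functions; the negative part of [f] only lowers the left-hand
    side. *)
Lemma le_integral_lower (f g : T -> \bar R) : (forall x, 0 <= g x) ->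
  (forall x, f x <= g x) -> \int[mu]_x f x <= \int[mu]_x g x.
Proof.
move=> g0 fg.
apply: (@le_trans _ _ (\int[mu]_x (f^\+ x))).
  rewrite [leLHS]integralE.
  have : 0 <= \int[mu]_x f^\- x by exact: integral_ge0.
  case: (\int[mu]_x f^\- x) => [r| |] //; last by rewrite addeNy leNye.
  by move=> r0; rewrite leeBlDr// leeDl.
rewrite !ge0_integralTE//; apply: le_ereal_sup => _ [h hf <-].
exists h => // x; apply: le_trans (hf x) _.
by rewrite funeposE ge_max fg g0.
Qed.

End NonmeasurableMonotonicity.

(** * Particle counts and tuples of particles *)

Section Counting.
Context {R : realType}.
Implicit Types (X : configuration R) (B : set R).

Definition count B X : nat := #|`fset_set (points X `&` B)|.

Lemma finite_points X B (a b : R) : B `<=` `[a, b] ->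
  finite_set (points X `&` B).
Proof.
move=> Bab; apply: sub_finite_set (locally_finite_points X a b).
exact: setIS.
Qed.

Lemma measurable_count_ge B (a b : R) n : measurable B -> B `<=` `[a, b] ->
  measurable ([set X | (n <= count B X)%N] : set (Conf R)).
Proof.
move=> mB Bab.
have meq m : measurable ([set X | count B X = m] : set (Conf R)).
  apply: sub_sigma_algebra; exists a, b, B, m; split=> //.
  apply/seteqP; split=> X /=.
    move=> <-; have fX := finite_points X Bab.
    by have [k Xk] := (finite_setP _).1 fX; rewrite /count (card_fset_set Xk).
  by move=> Xm; exact: card_fset_set.
have -> : [set X | (n <= count B X)%N] =
    ~` (\bigcup_(m in `I_n) [set X | count B X = m]) :> set (Conf R).
  apply/seteqP; split=> X /=.
    move=> nX -[m /= mn Xm].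
    by move: mn; rewrite -Xm ltnNge nX.
  rewrite leqNgt => H; apply/negP => Xn; apply: H.
  by exists (count B X).
by apply: measurableC; apply: fin_bigcup_measurable => // m _; exact: meq.
Qed.

Lemma distinct_tuple_of_count B (a b : R) n X : B `<=` `[a, b] ->
  (n <= count B X)%N ->
  exists2 t : n.-tuple R, distinct_tuples (points X) t & forall i, B (tnth t i).
Proof.
move=> Bab nX; have fX := finite_points X Bab.
pose s := take n (enum_fset (fset_set (points X `&` B))).
have ss : size s == n by rewrite size_take_min; apply/eqP/minn_idPl.
have sin x : x \in s -> (points X `&` B) x.
  by move=> /mem_take; rewrite in_fset_set// => /set_mem.
have tin (i : 'I_n) : (points X `&` B) (tnth (Tuple ss) i).
  by apply: sin; exact: mem_tnth.
exists (Tuple ss); last by move=> i; have [] := tin i.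
split; last by move=> i; have [] := tin i.
by rewrite /= take_uniq// fset_uniq.
Qed.

End Counting.

Section Tail.
Context {R : realType}.

Lemma lebesgue_int_tuple_le (B : set R) (v : R) (n : nat) (D : R)
    (F : n.-tuple R -> \bar R) : measurable B ->
  (@lebesgue_measure R B <= v%:E)%E -> 0 <= D ->
  (forall t, F t <= (D * \prod_(i < n) \1_B (tnth t i))%:E)%E ->
  (lebesgue_int_tuple F <= (D * v ^+ n)%:E)%E.
Proof.
move=> mB Bv; have v0 : 0 <= v by rewrite -lee_fin; exact: le_trans Bv.
elim: n D F => [|n IH] D F D0 FD.
  by apply: le_trans (FD _) _; rewrite big_ord0.
apply: (@le_trans _ _ (\int[@lebesgue_measure R]_x (D * v ^+ n * \1_B x)%:E)%E).
  apply: le_integral_lower => x; first by rewrite lee_fin !mulr_ge0 ?exprn_ge0.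
  rewrite mulrAC; apply: IH => [|t]; first by rewrite mulr_ge0.
  apply: le_trans (FD _) _; rewrite big_ord_recl mulrA tnth0 lee_fin.
  by under eq_bigr do rewrite tnthS.
under eq_integral do rewrite EFinM.
rewrite ge0_integralZl//; last 2 first.
- by apply/measurable_EFinP; exact: measurable_indic.
- by rewrite lee_fin mulr_ge0// exprn_ge0.
rewrite integral_indic// setIT exprSr mulrA [leRHS]EFinM.
by apply: lee_pmul => //; rewrite lee_fin mulr_ge0// exprn_ge0.
Qed.

(** On the event, some ordered [n]-tuple of distinct particles lies in [B], so its indicator is at
    most the sum over such tuples of the product of the indicators of [B]; the correlation function
    gives the expectation of that sum. *)
Lemma probability_count_ge (P : probability (Conf R) R) (rho : forall n, n.-tuple R -> R)
    (B : set R) (a b v D : R) (n : nat) :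
  is_correlation P (rho n) -> measurable B -> B `<=` `[a, b] ->
  (@lebesgue_measure R B <= v%:E)%E -> 0 <= D ->
  (forall t, (forall i, B (tnth t i)) -> rho n t <= D) ->
  (P [set X | (n <= count B X)%N] <= (D * v ^+ n)%:E)%E.
Proof.
move=> corr mB Bab Bv D0 rhoD.
pose f (t : n.-tuple R) : R := \prod_(i < n) \1_B (tnth t i).
have f0 t : 0 <= f t by apply: prodr_ge0 => i _.
have mf : measurable_fun setT f.
  apply: measurable_prod => i _.
  by apply: measurableT_comp; [exact: measurable_indic|exact: measurable_tnth].
apply: le_trans (@lebesgue_int_tuple_le B v n D
  (fun t => (f t * rho n t)%:E) mB Bv D0 _); last first.
  move=> t; rewrite lee_fin -/(f t) [leRHS]mulrC.
  have [tB|] := pselect (forall i, B (tnth t i)).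
    by apply: ler_wpM2l => //; exact: rhoD.
  move=> /existsNP[i nB]; rewrite /f (bigD1 i)//= indicE memNset//.
  by rewrite !mul0r.
pose E : set (Conf R) := [set X | (n <= count B X)%N].
have mE : measurable E := measurable_count_ge n mB Bab.
rewrite -(corr f mf f0) -/E.
have -> : P E = (\int[P]_X (\1_E X)%:E)%E by rewrite integral_indic// setIT.
apply: le_integral_lower => X; first by apply: esum_ge0 => t _; rewrite lee_fin.
rewrite indicE; case: (boolP (X \in E)) => [|_]; last first.
  by apply: esum_ge0 => t _; rewrite lee_fin.
move=> /set_mem/(distinct_tuple_of_count Bab)[t Xt Bt].
apply: esum_ge; exists [set t]; first by split=> // _ ->.
by rewrite fsbig_set1 /f big1// => i _; rewrite indicE mem_set//; exact: Bt.
Qed.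

End Tail.

(** * Exponential moments of the squared count *)

Section ExponentialMoment.
Context {R : realType}.

(** Comes from [ln y <= y] at [y = expR (4 * sigma * (t + kap + 2)) / n ^ 2], multiplied by
    [n ^ 2 / (4 * sigma)]. The extra 2 leaves the term [- (2 * n ^ 2)], which makes the tails
    summable. *)
Definition moment_rate (kap sigma : R) : R :=
  expR (4 * sigma * (kap + 2)) / (4 * sigma).

Definition moment_const (kap sigma : R) : R :=
  moment_rate kap sigma + expR (moment_rate kap sigma) / (4 * sigma).

(* The exponent [n^2 (t + kap - ln n / (2 sigma))] is maximal where [n^2] is a
   multiple of [exp (4 sigma t)], and so is its maximum. *)
Lemma expR_sq_le (kap sigma t : R) (n : nat) : 0 < sigma -> (0 < n)%N ->
  t * n%:R ^+ 2 + (kap * n%:R ^+ 2 - n%:R ^+ 2 * ln n%:R / (2 * sigma)) <=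
  - (2 * n%:R ^+ 2) + moment_rate kap sigma * expR (4 * sigma * t).
Proof.
move=> s0 n0; set m : R := n%:R; have m0 : 0 < m by rewrite ltr0n.
have m20 : 0 < m ^+ 2 by rewrite exprn_gt0.
pose y := expR (4 * sigma * (t + kap + 2)) / m ^+ 2.
have y0 : 0 < y by rewrite divr_gt0 ?expR_gt0.
have lny : ln y = 4 * sigma * (t + kap + 2) - 2 * ln m.
  rewrite ln_div ?posrE ?expR_gt0// expRK lnXn//.
  by rewrite -[ln m *+ 2]mulr_natl.
have : ln y <= y by apply/ltW/ln_sublinear.
have k0 : 0 <= m ^+ 2 / (4 * sigma) by rewrite divr_ge0 ?sqr_ge0//; lra.
move=> /(ler_wpM2l k0); rewrite lny.
have -> : m ^+ 2 / (4 * sigma) * y =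
    moment_rate kap sigma * expR (4 * sigma * t).
  rewrite /y /moment_rate; have -> : 4 * sigma * (t + kap + 2) =
    4 * sigma * (kap + 2) + 4 * sigma * t by ring.
  by rewrite expRD; field; lra.
have -> : m ^+ 2 / (4 * sigma) * (4 * sigma * (t + kap + 2) - 2 * ln m) =
  m ^+ 2 * (t + kap + 2) - m ^+ 2 * ln m / (2 * sigma) by field; lra.
lra.
Qed.

(** The inequality [expR u - 1 <= u * expR u] keeps a factor [t], so that the final bound can tend
    to 1 with [t]. Half of the spare decay absorbs [n ^ 2], the other half gives [2 ^- n]. *)
Lemma expR_sq_tail (kap sigma t : R) (n : nat) : 0 < sigma -> 0 < t ->
  (0 < n)%N ->
  (expR (t * n%:R ^+ 2) - 1) *
    expR (kap * n%:R ^+ 2 - n%:R ^+ 2 * ln n%:R / (2 * sigma)) <=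
  t * expR (moment_rate kap sigma * expR (4 * sigma * t)) / 2 ^+ n.
Proof.
move=> s0 t0 n0; set p := expR (kap * _ - _).
set L := moment_rate kap sigma * expR (4 * sigma * t).
have n20 : 0 <= n%:R ^+ 2 :> R by exact: sqr_ge0.
have h1 : expR (t * n%:R ^+ 2) - 1 <= t * n%:R ^+ 2 * expR (t * n%:R ^+ 2).
  have := @expR_ge1Dx R (- (t * n%:R ^+ 2)).
  move=> /(ler_wpM2r (expR_ge0 (t * n%:R ^+ 2))).
  rewrite -expRD addNr expR0; lra.
have h2 : expR (t * n%:R ^+ 2) * p <= expR (- (2 * n%:R ^+ 2)) * expR L.
  by rewrite -!expRD ler_expR; exact: expR_sq_le.
have h3 : n%:R ^+ 2 * expR (- (2 * n%:R ^+ 2)) <= (2 ^+ n)^-1 :> R.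
  have -> : - (2 * n%:R ^+ 2) = - n%:R ^+ 2 + - n%:R ^+ 2 :> R by lra.
  rewrite expRD mulrA -[leRHS]mul1r; apply: ler_pM; rewrite ?mulr_ge0 ?expR_ge0//.
    rewrite expRN ler_pdivrMr ?expR_gt0// mul1r.
    by have := @expR_ge1Dx R (n%:R ^+ 2); lra.
  rewrite expRN lef_pV2 ?posrE ?expR_gt0 ?exprn_gt0//.
  apply: le_trans (_ : expR n%:R <= _).
    rewrite -[n%:R]mulr1 expRM_natl lerXn2r ?nnegrE ?expR_ge0//.
    by have := @expR_ge1Dx R 1; lra.
  by rewrite ler_expR -natrX ler_nat -{1}(expn1 n) leq_pexp2l.
apply: le_trans (ler_wpM2r (expR_ge0 _) h1) _.
have -> : t * n%:R ^+ 2 * expR (t * n%:R ^+ 2) * p =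
  t * n%:R ^+ 2 * (expR (t * n%:R ^+ 2) * p) by ring.
apply: le_trans (ler_wpM2l (mulr_ge0 (ltW t0) n20) h2) _.
have -> : t * n%:R ^+ 2 * (expR (- (2 * n%:R ^+ 2)) * expR L) =
  t * expR L * (n%:R ^+ 2 * expR (- (2 * n%:R ^+ 2))) by ring.
by apply: ler_wpM2l h3; rewrite mulr_ge0 ?expR_ge0// ltW.
Qed.

(** With [E = expR (4 * sigma * t) - 1], the factor [t] is at most [E / (4 * sigma)]; once
    [expR (L * E)] is factored out, [1 + C * E <= expR (C * E)] concludes. *)
Lemma moment_const_le (kap sigma t : R) : 0 < sigma -> 0 < t ->
  1 + t * expR (moment_rate kap sigma * expR (4 * sigma * t)) <=
  expR (moment_const kap sigma * (expR (4 * sigma * t) - 1)).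
Proof.
move=> s0 t0; rewrite /moment_const; set L := moment_rate kap sigma.
have L0 : 0 <= L by rewrite divr_ge0 ?expR_ge0//; lra.
set E := expR (4 * sigma * t) - 1.
have E4 : 4 * sigma * t <= E by have := @expR_ge1Dx R (4 * sigma * t); rewrite /E; lra.
have E0 : 0 <= E by apply: le_trans E4; rewrite !mulr_ge0// ltW.
have -> : L * expR (4 * sigma * t) = L + L * E by rewrite /E; ring.
rewrite expRD; set C := expR L / (4 * sigma).
have tC : t * expR L <= C * E.
  have -> : t * expR L = C * (4 * sigma * t) by rewrite /C; field; lra.
  by apply: ler_wpM2l => //; rewrite divr_ge0 ?expR_ge0//; lra.
have eLE : 1 <= expR (L * E) by rewrite -expR0 ler_expR mulr_ge0.
apply: le_trans (_ : expR (L * E) * (1 + C * E) <= _).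
  have := ler_wpM2r (expR_ge0 (L * E)) tC; lra.
rewrite mulrDl expRD; apply: ler_wpM2l; first exact: expR_ge0.
exact: expR_ge1Dx.
Qed.

(** Summation by parts: [W] is 1 plus the series of the increments of [expR (t * k ^ 2)] times the
    indicators of the tail events, which is measurable and integrates term by term. *)
Lemma exp_square_moment (P : probability (Conf R) R) (B : set R)
    (a b kap sigma t : R) : measurable B -> B `<=` `[a, b] ->
  0 < sigma -> 0 < t ->
  (forall n, (0 < n)%N -> (P [set X | (n <= count B X)%N] <=
    (expR (kap * n%:R ^+ 2 - n%:R ^+ 2 * ln n%:R / (2 * sigma)))%:E)%E) ->
  exists W : Conf R -> \bar R, [/\ measurable_fun setT W,
    forall X, (0 <= W X)%E,
    forall X, ((expR (t * (count B X)%:R ^+ 2))%:E <= W X)%E &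
    (\int[P]_X W X <= (expR (moment_const kap sigma *
       (expR (4 * sigma * t) - 1)))%:E)%E].
Proof.
move=> mB Bab s0 t0 tail.
pose g k : R := expR (t * k%:R ^+ 2).
pose En k : set (Conf R) := [set X | (k.+1 <= count B X)%N].
have mE k : measurable (En k) := measurable_count_ge k.+1 mB Bab.
pose c k : R := g k.+1 - g k.
have c0 k : 0 <= c k.
  rewrite subr_ge0 ler_expR ler_wpM2l ?(ltW t0)//.
  by rewrite lerXn2r ?nnegrE// ler_nat.
pose u k (X : Conf R) : \bar R := ((c k)%:E * (\1_(En k) X)%:E)%E.
have u0 k X : (0 <= u k X)%E by rewrite mule_ge0 ?lee_fin.
have mu k : measurable_fun setT (u k).
  apply: measurable_funeM; apply/measurable_EFinP; exact: measurable_indic.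
have ms : measurable_fun setT (fun X => \sum_(0 <= k <oo) u k X)%E.
  exact: (ge0_emeasurable_sum (P := xpredT)).
have sum0 X : (0 <= \sum_(0 <= k <oo) u k X)%E by exact: nneseries_ge0.
exists (fun X => 1 + \sum_(0 <= k <oo) u k X)%E; split.
- by apply: emeasurable_funD.
- by move=> X; rewrite adde_ge0.
- move=> X; apply: (@le_trans _ _ (1 + \sum_(0 <= k < count B X) u k X)%E).
    rewrite (eq_big_nat _ _ (F2 := fun k => (c k)%:E)); last first.
      move=> k /andP[_ kN]; rewrite /u indicE mem_set ?mule1//.
    rewrite sumEFin telescope_sumr// -EFinD lee_fin /g expr0n mulr0 expR0; lra.
  by rewrite leeD2l// nneseries_lim_ge.
rewrite ge0_integralD//.
have -> : (\int[P]_X 1 = 1)%E.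
  rewrite integral_cst// mul1e. exact: probability_setT.
rewrite integral_nneseries//.
set T := t * expR (moment_rate kap sigma * expR (4 * sigma * t)).
have T0 : 0 <= T by rewrite mulr_ge0 ?expR_ge0// ltW.
apply: le_trans (_ : 1 + T%:E <= _)%E; last first.
  by rewrite -EFinD lee_fin moment_const_le.
rewrite leeD2l//.
have -> : T%:E = (\sum_(0 <= k <oo) (T / (2 ^ (k + 1))%:R)%:E)%E.
  apply/esym/cvg_lim => //; have := @cvg_geometric_eseries_half R T 0.
  by rewrite expr0 divr1.
apply: lee_nneseries => [k _ _|k _]; first exact: integral_ge0.
rewrite ge0_integralZl ?lee_fin//; last first.
  by apply/measurable_EFinP; exact: measurable_indic.
rewrite integral_indic// setIT.
apply: le_trans (_ : (expR (t * k.+1%:R ^+ 2) - 1)%:E * P (En k) <= _)%E.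
  apply: lee_pmul => //; first by rewrite lee_fin.
  by rewrite lee_fin lerB// -expR0 ler_expR mulr_ge0 ?sqr_ge0// ltW.
have e0 : 0 <= expR (t * k.+1%:R ^+ 2) - 1.
  by rewrite subr_ge0 -expR0 ler_expR mulr_ge0 ?sqr_ge0// ltW.
have e0' : (0 <= (expR (t * k.+1%:R ^+ 2) - 1)%:E)%E by rewrite lee_fin.
have /le_trans := @lee_wpmul2l _ _ e0' _ _ (tail k.+1 isT); apply.
by rewrite -EFinM lee_fin addn1 natrX; exact: expR_sq_tail.
Qed.

End ExponentialMoment.

(** * Sums over pairs of particles *)

Section PairSums.
Context {R : realType}.

(** A single enumeration, valid for all nonnegative families, turns sums over squares into series
    that can be integrated termwise. *)
Lemma int2_enum : exists e : nat -> int * int,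
  forall a : int * int -> \bar R,
    (forall kl, (0 <= a kl)%E) ->
    (\esum_(kl in [set: int * int]) a kl = \sum_(0 <= n <oo) a (e n))%E.
Proof.
pose f n := (Posz n, Posz 0).
have fI : {in [set: nat] &, injective f} by move=> m n _ _ [].
have /card_set_bijP[g gbij] : ([set: int * int] #= [set: nat])%card.
  apply: eq_card_nat; first exact: countableP.
  move=> /(sub_finite_set (@subsetT _ (f @` setT))).
  by rewrite (eq_finite_set (inj_card_eq fI)); exact: infinite_nat.
have [_ /in2TT ginj _] := gbij.
pose e n := xget (0, 0) [set kl | g kl = n].
have ge kl : e (g kl) = kl.
  by rewrite /e; case: xgetP => [kl' _ /ginj//|/(_ kl)/(_ erefl)].
exists e => a a0.
rewrite nneseries_esumT// (reindex_esum _ _ _ (fun n => a (e n)) gbij).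
by apply: eq_esum => kl _; rewrite ge.
Qed.

(** The floor of a number and its successor are both within 1 of it, which gives four distinct
    squares, each contributing at least [q / 4]. *)
Lemma le_four_cells (x y : R) (a : int * int -> R) (q : R) (B : int -> set R) :
  (forall kl, 0 <= a kl) ->
  (forall k, `|x - k%:~R| <= 1 -> B k x) ->
  (forall k, `|y - k%:~R| <= 1 -> B k y) ->
  (forall kl : int * int, `|x - kl.1%:~R| <= 1 -> `|y - kl.2%:~R| <= 1 ->
     q <= a kl) ->
  (q%:E <= \esum_(kl in [set: int * int])
     (a kl / 4 * (\1_(B kl.1) x * \1_(B kl.2) y))%:E)%E.
Proof.
move=> a0 Bx By qa.
have near z : [/\ `|z - (Num.floor z)%:~R| <= 1 &
    `|z - (Num.floor z + 1)%:~R| <= 1 :> R].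
  have /andP[f1 f2] := floor_itv z.
  by rewrite !ler_norml; move: f2; rewrite intrD /= => f2; split; lra.
have [x1 x2] := near x; have [y1 y2] := near y.
set k := Num.floor x in x1 x2; set l := Num.floor y in y1 y2.
pose r := [:: (k, l); (k + 1, l); (k, l + 1); (k + 1, l + 1)].
have kk : k != k + 1 by rewrite -[X in X != _]addr0 (inj_eq (addrI k)).
have ll : l != l + 1 by rewrite -[X in X != _]addr0 (inj_eq (addrI l)).
have ur : uniq r.
  rewrite /= !inE !xpair_eqE !eqxx ![_ + 1 == _]eq_sym.
  by rewrite (negbTE kk) (negbTE ll).
apply: esum_ge; exists [set` r].
  by split=> //; exact: finite_seq.
rewrite -(fsbig_seq _ _ ur) !big_cons big_nil /= adde0 -!EFinD lee_fin.
rewrite !indicE !mem_set; do ?[exact: Bx|exact: By].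
rewrite !mulr1; have := qa (k, l) x1 y1; have := qa (k + 1, l) x2 y1.
have := qa (k, l + 1) x1 y2; have := qa (k + 1, l + 1) x2 y2.
lra.
Qed.

(** For a finite set of pairs of particles the two sums can be exchanged, and at most [N_k * N_l] of
    the pairs lie in [B k] times [B l]. *)
Lemma esum_pairs_le (X : configuration R) (a : int * int -> R)
    (q : R -> R -> R) (B : int -> set R) (U : set R) :
  (forall kl, 0 <= a kl) -> (forall x y, 0 <= q x y) ->
  (forall x y, q x y != 0 -> U x /\ U y) ->
  (forall k, B k = `[k%:~R - 1, k%:~R + 1] `&` U) ->
  (forall x y (kl : int * int), `|x - kl.1%:~R| <= 1 -> `|y - kl.2%:~R| <= 1 ->
     q x y <= a kl) ->
  (\esum_(xy in points X `*` points X) (q xy.1 xy.2)%:E <=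
   \esum_(kl in [set: int * int])
     (a kl / 4 * ((count (B kl.1) X)%:R * (count (B kl.2) X)%:R))%:E)%E.
Proof.
move=> a0 q0 qU BE qa.
have inB k x : U x -> `|x - k%:~R| <= 1 -> B k x.
  move=> Ux; rewrite BE ler_norml => h; split=> //=.
  by rewrite in_itv/=; lra.
pose h (kl : int * int) (xy : R * R) : \bar R :=
  (a kl / 4 * (\1_(B kl.1) xy.1 * \1_(B kl.2) xy.2))%:E.
have h0 kl xy : (0 <= h kl xy)%E.
  by rewrite lee_fin !mulr_ge0 ?invr_ge0.
apply: ge_ereal_sup => _ [F [finF FX] <-].
rewrite fsbig_finite//=.
apply: (@le_trans _ _ (\sum_(xy <- fset_set F)
    \esum_(kl in [set: int * int]) h kl xy)%E).
  apply: lee_sum => -[x y] _ /=.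
  have [->|qxy] := eqVneq (q x y) 0; first by apply: esum_ge0 => kl _.
  have [Ux Uy] := qU _ _ qxy.
  by apply: le_four_cells => // k; [exact: inB|exact: inB|exact: qa].
rewrite -esum_sum//; apply: le_esum => -[k l] _ /=.
rewrite sumEFin lee_fin -mulr_sumr; apply: ler_wpM2l.
  by rewrite mulr_ge0 ?invr_ge0.
have Bk m : B m `<=` `[m%:~R - 1, m%:~R + 1] by rewrite BE; exact: subIsetl.
have fB m := finite_points X (Bk m).
rewrite -natrM.
pose p (xy : R * R) := (xy.1 \in points X `&` B k) && (xy.2 \in points X `&` B l).
apply: le_trans (_ : \sum_(xy <- fset_set F) (p xy : nat)%:R <= _).
  rewrite big_seq [leRHS]big_seq; apply: ler_sum => -[x y].
  rewrite in_fset_set// => /set_mem/FX[/= Xx Xy].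
  rewrite /p !indicE !in_setI !(mem_set Xx, mem_set Xy)/=.
  by case: (x \in B k); case: (y \in B l); rewrite ?mulr0 ?mul0r ?mulr1.
rewrite -natr_sum ler_nat.
have -> : (\sum_(xy <- fset_set F) p xy)%N = seq.count p (fset_set F).
  by rewrite -sum1_count [RHS]big_mkcond; apply: eq_bigr => xy _; case: (p xy).
rewrite -size_filter /count.
rewrite -(size_allpairs pair); apply: uniq_leq_size.
  by rewrite filter_uniq// fset_uniq.
move=> [x y]; rewrite mem_filter => /andP[/andP[/= px py] _].
by apply/allpairsP; exists (x, y); split; rewrite ?in_fset_set.
Qed.

(* Jensen's inequality through the tangent line at the mean. *)
Lemma expR_series_le (w x : nat -> R) (y : R) :
  (forall n, 0 <= w n) -> (forall n, 0 <= x n) ->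
  (\sum_(0 <= n <oo) (w n)%:E = 1)%E ->
  (\sum_(0 <= n <oo) (w n * x n)%:E = y%:E)%E ->
  ((expR y)%:E <= \sum_(0 <= n <oo) (w n * expR (x n))%:E)%E.
Proof.
move=> w0 x0 w1 wx.
have y0 : 0 <= y.
  by rewrite -lee_fin -wx; apply: nneseries_ge0 => n _ _; rewrite lee_fin mulr_ge0.
have ey0 : 0 <= expR y by exact: expR_ge0.
set S := (\sum_(0 <= n <oo) (w n * expR (x n))%:E)%E.
have L : (S + (expR y * y)%:E =
    \sum_(0 <= n <oo) ((w n * expR (x n))%:E + (expR y * y)%:E * (w n)%:E))%E.
  rewrite nneseriesD => [|n _ _|n _ _].
  - by rewrite nneseriesZl => [|n _]; rewrite ?w1 ?mule1// lee_fin.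
  - by rewrite lee_fin mulr_ge0// expR_ge0.
  - by rewrite -EFinM lee_fin !mulr_ge0.
have Rr : ((expR y + expR y * y)%:E =
    \sum_(0 <= n <oo) ((expR y)%:E * (w n)%:E + (expR y)%:E * (w n * x n)%:E))%E.
  rewrite nneseriesD => [|n _ _|n _ _].
  - rewrite !nneseriesZl => [|n _|n _]; rewrite ?w1 ?wx ?mule1 ?EFinD ?EFinM// ?mule_ge0 ?lee_fin//.
  - by rewrite -EFinM lee_fin mulr_ge0.
  - by rewrite -EFinM lee_fin !mulr_ge0.
have : ((expR y + expR y * y)%:E <= S + (expR y * y)%:E)%E.
  rewrite L Rr; apply: lee_nneseries => n _.
    by move=> _; rewrite -!EFinM -EFinD lee_fin addr_ge0 ?mulr_ge0.
  rewrite -!EFinM -!EFinD lee_fin.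
  have := @expR_ge1Dx R (x n - y).
  move=> /(ler_wpM2l (mulr_ge0 (w0 n) ey0)).
  have -> : w n * expR y * expR (x n - y) = w n * expR (x n).
    by rewrite -mulrA -expRD addrC subrK.
  lra.
by rewrite EFinD leeD2rE.
Qed.

End PairSums.

(** * A measurable majorant of the exponential *)

Section Domination.
Context {R : realType}.

(** Arithmetic-geometric mean, on [u * v] and then on the exponentials; it separates the counts of
    two different intervals. *)
Lemma expR_mul_le (t u v : R) : 0 <= t ->
  expR (t * (u * v)) <= (expR (t * u ^+ 2) + expR (t * v ^+ 2)) / 2.
Proof.
move=> t0; apply: le_trans (_ : expR (t * u ^+ 2 / 2 + t * v ^+ 2 / 2) <= _).
  rewrite ler_expR; have := mulr_ge0 t0 (sqr_ge0 (u - v)).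
  rewrite !expr2; lra.
have sq (x : R) : expR x = expR (x / 2) ^+ 2 by rewrite -expRM_natl mulrC divfK.
rewrite expRD (sq (t * u ^+ 2)) (sq (t * v ^+ 2)).
have := sqr_ge0 (expR (t * u ^+ 2 / 2) - expR (t * v ^+ 2 / 2)).
rewrite !expr2; lra.
Qed.

(** The real part of the pair sum is at most the sum of the positive parts. That sum is finite
    thanks to [Y], so [fine] returns its true value, and the subtracted [fine] is nonnegative in any
    case. *)
Lemma normc_cexp_le (q : R -> R -> R[i]) (X : configuration R) (lambda Y : R) :
  0 < lambda ->
  (\esum_(xy in points X `*` points X) (normc (q xy.1 xy.2))%:E <= Y%:E)%E ->
  normc (cexp (lambda%:C * pair_functional q X)) <= expR (lambda * Y).
Proof.
move=> l0 qY; rewrite /cexp normcM normcR ger0_norm ?expR_ge0//.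
rewrite [X in _ * X](_ : _ = 1); last by rewrite /= cos2Dsin2 sqrtr1.
rewrite mulr1 ler_expR /= mul0r subr0 ler_pM2l// /rsum.
set f := fun xy : R * R => _; set D := _ `*` _.
have fq : (\esum_(i in D) (Num.max (complex.Re (q i.1 i.2)) 0)%:E <= Y%:E)%E.
  apply: le_trans qY; apply: le_esum => xy _.
  rewrite lee_fin ge_max normc_ge0 andbT.
  exact: le_trans (ler_norm _) (Re_le_normc _).
have f0 : (0 <= \esum_(i in D) (Num.max (complex.Re (q i.1 i.2)) 0)%:E)%E.
  by apply: esum_ge0 => xy _; rewrite lee_fin le_max lexx orbT.
have g0 : 0 <= fine (\esum_(i in D) (Num.max (- complex.Re (q i.1 i.2)) 0)%:E).
  by apply/fine_ge0/esum_ge0 => xy _; rewrite lee_fin le_max lexx orbT.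
apply: le_trans (_ : fine (\esum_(i in D) (Num.max (complex.Re (q i.1 i.2)) 0)%:E) <= _).
  by rewrite gerBl.
move: f0 fq; case: (\esum_(i in D) _)%E => [r| |] //=.
Qed.

(** [H] averages the majorants [W] of both intervals of each square, with Jensen's weights
    [b n / Q]. The real [Y] exists only where [H] is finite. *)
Lemma exp_pairs_dominated (P : probability (Conf R) R) (B : int -> set R)
    (kap sigma lambda Q : R) (b : nat -> R) (e : nat -> int * int) :
  0 < sigma -> 0 < lambda -> 0 < Q ->
  (forall k, measurable (B k)) ->
  (forall k : int, B k `<=` `[k%:~R - 1, k%:~R + 1]) ->
  (forall k n, (0 < n)%N -> (P [set X | (n <= count (B k) X)%N] <=
    (expR (kap * n%:R ^+ 2 - n%:R ^+ 2 * ln n%:R / (2 * sigma)))%:E)%E) ->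
  (forall n, 0 <= b n) -> (\sum_(0 <= n <oo) (b n)%:E = Q%:E)%E ->
  exists H : Conf R -> \bar R, [/\ measurable_fun setT H,
    forall X, (0 <= H X)%E,
    (\int[P]_X H X <= (expR (moment_const kap sigma *
       (expR (Q * lambda * sigma) - 1)))%:E)%E &
    forall X, (H X < +oo)%E -> exists2 Y : R,
      (\sum_(0 <= n <oo) (b n / 4 * ((count (B (e n).1) X)%:R *
         (count (B (e n).2) X)%:R))%:E <= Y%:E)%E &
      ((expR (lambda * Y))%:E <= H X)%E].
Proof.
move=> s0 l0 Q0 mB Bk tail b0 bQ.
pose t := lambda * Q / 4; have t0 : 0 < t by rewrite divr_gt0 ?mulr_gt0.
have /choice[W HW] := fun k => exp_square_moment (mB k) (Bk k) s0 t0 (tail k).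
have mW k : measurable_fun setT (W k) by have [] := HW k.
have W0 k X : (0 <= W k X)%E by have [_ ->] := HW k.
have WN k X : ((expR (t * (count (B k) X)%:R ^+ 2))%:E <= W k X)%E.
  by have [_ _ ->] := HW k.
set Bd := expR _; have IW k : (\int[P]_X W k X <= Bd%:E)%E.
  have [_ _ _] := HW k; rewrite /Bd; congr (_ <= (expR (_ * (expR _ - 1)))%:E)%E.
  by rewrite /t; field.
pose w n := b n / Q; have w0 n : 0 <= w n by rewrite divr_ge0// ltW.
have w1 : (\sum_(0 <= n <oo) (w n)%:E = 1)%E.
  have -> : (\sum_(0 <= n <oo) (w n)%:E =
      \sum_(0 <= n <oo) (Q^-1)%:E * (b n)%:E)%E.
    by apply: eq_eseriesr => n _; rewrite -EFinM mulrC.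
  rewrite nneseriesZl => [|n _]; last by rewrite lee_fin.
  by rewrite bQ -EFinM mulVf// gt_eqF.
pose h n (X : Conf R) : \bar R := ((w n / 2)%:E * (W (e n).1 X + W (e n).2 X))%E.
have h0 n X : (0 <= h n X)%E.
  by rewrite mule_ge0 ?adde_ge0// lee_fin divr_ge0.
have mh n : measurable_fun setT (h n).
  by apply: measurable_funeM; exact: emeasurable_funD.
exists (fun X => \sum_(0 <= n <oo) h n X)%E; split.
- exact: (ge0_emeasurable_sum (P := xpredT)).
- by move=> X; apply: nneseries_ge0.
- rewrite integral_nneseries//.
  have -> : Bd%:E = (\sum_(0 <= n <oo) (Bd%:E * (w n)%:E))%E.
    rewrite nneseriesZl => [|n _]; last by rewrite lee_fin.
    by rewrite w1 mule1.
  apply: lee_nneseries => [n _ _|n _]; first exact: integral_ge0.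
  rewrite ge0_integralZl//; last 3 first.
  + exact: emeasurable_funD.
  + by move=> X _; rewrite adde_ge0.
  + by rewrite lee_fin divr_ge0.
  rewrite ge0_integralD//.
  have w2 : (0 <= (w n / 2)%:E :> \bar R)%E by rewrite lee_fin divr_ge0.
  have /le_trans := @lee_wpmul2l _ _ w2 _ _ (leeD (IW (e n).1) (IW (e n).2)).
  by apply; rewrite -EFinD -!EFinM lee_fin; lra.
move=> X HX.
pose x n : R := t * ((count (B (e n).1) X)%:R * (count (B (e n).2) X)%:R).
have x0 n : 0 <= x n by rewrite mulr_ge0 ?mulr_ge0// ltW.
have whX : (\sum_(0 <= n <oo) (w n * expR (x n))%:E <= \sum_(0 <= n <oo) h n X)%E.
  apply: lee_nneseries => [n _ _|n _].
    by rewrite lee_fin mulr_ge0// expR_ge0.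
  have w2 : (0 <= (w n / 2)%:E :> \bar R)%E by rewrite lee_fin divr_ge0.
  have := @lee_wpmul2l _ _ w2 _ _ (leeD (WN (e n).1 X) (WN (e n).2 X)).
  apply: le_trans; rewrite -EFinD -EFinM lee_fin.
  have := ler_wpM2l (w0 n) (expR_mul_le (count (B (e n).1) X)%:R
    (count (B (e n).2) X)%:R (ltW t0)).
  by rewrite -/(x n); lra.
(* Since [x <= expR x], finiteness of [H] makes the exponents summable, and their mean [y] is a real
   number. *)
have wxh : (\sum_(0 <= n <oo) (w n * x n)%:E <= \sum_(0 <= n <oo) h n X)%E.
  apply: le_trans whX; apply: lee_nneseries => [n _ _|n _].
    by rewrite lee_fin mulr_ge0.
  rewrite lee_fin; apply: ler_wpM2l => //.
  by have := @expR_ge1Dx R (x n); lra.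
have wx0 : (0 <= \sum_(0 <= n <oo) (w n * x n)%:E)%E.
  by apply: nneseries_ge0 => n _ _; rewrite lee_fin mulr_ge0.
have [y wxy] : exists y : R, (\sum_(0 <= n <oo) (w n * x n)%:E = y%:E)%E.
  move: wx0 (le_lt_trans wxh HX).
  by case: (\sum_(0 <= n <oo) (w n * x n)%:E)%E => // r _ _; exists r.
exists (y / lambda); last first.
  rewrite [lambda * _]mulrC divfK ?gt_eqF//.
  by apply: le_trans whX; exact: expR_series_le.
have -> : (\sum_(0 <= n <oo) (b n / 4 * ((count (B (e n).1) X)%:R *
    (count (B (e n).2) X)%:R))%:E =
  \sum_(0 <= n <oo) (lambda^-1)%:E * (w n * x n)%:E)%E.
  apply: eq_eseriesr => n _; rewrite -EFinM /w /x /t; congr (_%:E).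
  by field; rewrite !gt_eqF.
rewrite nneseriesZl => [|n _]; last by rewrite lee_fin mulr_ge0.
by rewrite wxy -EFinM mulrC.
Qed.

End Domination.

(** * The squares of the norm, and the theorem *)

Section Norm1oo.
Context {R : realType}.

Definition cell_sup (q : R -> R -> R[i]) (kl : int * int) : \bar R :=
  ereal_sup [set (normc (q xy.1 xy.2))%:E | xy in
    [set xy : R * R | `|xy.1 - kl.1%:~R| <= 1 /\ `|xy.2 - kl.2%:~R| <= 1]].

Lemma cell_sup_ge (q : R -> R -> R[i]) kl x y :
  `|x - kl.1%:~R| <= 1 -> `|y - kl.2%:~R| <= 1 ->
  ((normc (q x y))%:E <= cell_sup q kl)%E.
Proof. by move=> xk yl; apply: ereal_sup_ubound; exists (x, y). Qed.

Lemma cell_sup_ge0 (q : R -> R -> R[i]) kl : (0 <= cell_sup q kl)%E.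
Proof.
apply: le_trans (cell_sup_ge (x := kl.1%:~R) (y := kl.2%:~R) q _ _).
- by rewrite lee_fin normc_ge0.
- by rewrite subrr normr0.
- by rewrite subrr normr0.
Qed.

Lemma cell_sup_fin (q : R -> R -> R[i]) kl : (norm1oo q < +oo)%E ->
  cell_sup q kl \is a fin_num.
Proof.
move=> qfin; rewrite ge0_fin_numE ?cell_sup_ge0//.
apply: le_lt_trans qfin; apply: esum_ge; exists [set kl]; first by split.
by rewrite fsbig_set1.
Qed.

End Norm1oo.

(** The modulus stands under the expectation because [q] is complex. Almost sure summability
    guarantees that [pair_functional] is a genuine sum and not the default value of [rsum]. *)
Theorem corollary1 (R : realType) (A M sigma s : R) :
  0 < A -> 0 < M -> 0 < sigma ->
  exists c : R, 0 < c /\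
  forall (K : R -> R -> R[i]) (P : probability (Conf R) R) (U : set R)
         (Kt : R[i] -> R[i] -> R[i]) (rho : R -> R) (q : R -> R -> R[i]),
  projection_kernel K ->
  determinantal K P ->
  open U ->
  (forall w, entire (fun z => Kt z w)) ->
  (forall z w, Kt z w = (Kt w z)^*) ->
  (forall x y : R, complex.Im (Kt x%:C y%:C) = 0) ->
  (forall p, U p -> 0 < rho p) ->
  {within U, continuous rho} ->
  has_ubound (rho @` U) ->
  sup (rho @` U) = s ->
  (forall p z, U p ->
    normc (Kt p%:C z) <= A * expR (M * normc (z - p%:C) `^ sigma)) ->
  (forall x y, U x -> U y -> K x y = (rho x * rho y)%:C * Kt x%:C y%:C) ->
  (forall x y, q x y != 0 -> U x /\ U y) ->
  (norm1oo q < +oo)%E ->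
  {ae P, forall X : Conf R, pair_summable q X} /\
  forall lambda : R, 0 < lambda ->
    ('E_P[fun X : Conf R => (normc (cexp (lambda%:C * pair_functional q X)))%R] <=
     (expR (c * (expR (fine (norm1oo q) * lambda * sigma) - 1)))%R%:E)%E.
Proof.
move=> A0 M0 s0; pose kap := det_const A M sigma s.
have rate0 : 0 <= moment_rate kap sigma.
  by rewrite divr_ge0 ?expR_ge0// mulr_ge0// ltW.
exists (moment_const kap sigma); split.
  by rewrite ltr_wpDl// divr_gt0 ?expR_gt0// mulr_gt0.
move=> K P U Kt rho q _ Pdet Uo Kent Ksym _ rho0 _ rhob rhos KA KKt qU qfin.
have rhoU p : U p -> 0 < rho p <= s.
  move=> Up; rewrite rho0//= -rhos; apply: sup_upper_bound; last by exists p.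
  by split=> //; exists (rho p); exists p.
pose B (k : int) : set R := `[k%:~R - 1, k%:~R + 1] `&` U.
have mB k : measurable (B k).
  by apply: measurableI => //; exact: open_measurable.
have Bk (k : int) : B k `<=` `[k%:~R - 1, k%:~R + 1] by exact: subIsetl.
have vB k : (@lebesgue_measure R (B k) <= 2%:E)%E.
  apply: (@le_trans _ _ (@lebesgue_measure R `[k%:~R - 1, k%:~R + 1])).
    by apply: le_measure => //; apply/mem_set => //; exact: mB.
  rewrite lebesgue_measure_itv/=; case: ifP => _; last by rewrite lee_fin.
  by rewrite -EFinD lee_fin; lra.
have tail k n : (0 < n)%N -> (P [set X | (n <= count (B k) X)%N] <=
    (expR (kap * n%:R ^+ 2 - n%:R ^+ 2 * ln n%:R / (2 * sigma)))%:E)%E.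
  move=> n0; set D := expR _.
  (* [D / 2 ^+ n] bounds the correlation function on tuples in [B k]; [2 ^+ n] bounds their
     volume. *)
  have -> : D = D / 2 ^+ n * 2 ^+ n by rewrite divfK// expf_neq0.
  have D0 : 0 <= D / 2 ^+ n by rewrite divr_ge0 ?expR_ge0// exprn_ge0.
  apply: (probability_count_ge (rho := fun n (t : n.-tuple R) => complex.Re
    (\det (\matrix_(i < n, j < n) K (tnth t i) (tnth t j))))
    (Pdet n) (mB k) (Bk k) (vB k) D0) => t tB.
  apply: le_trans (ler_norm _) _; apply: le_trans (Re_le_normc _) _.
  rewrite ler_pdivlMr ?exprn_gt0//.
  apply: (normc_kernel_det (p := k%:~R) A0 M0 s0 n0 Kent Ksym rhoU KA KKt).
    by move=> i; have [] := tB i.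
  move=> i; have [+ _] := tB i; rewrite /= in_itv/= ler_norml; lra.
have [e He] := @int2_enum R.
pose a kl := fine (cell_sup q kl).
have aE kl : (a kl)%:E = cell_sup q kl by rewrite fineK// cell_sup_fin.
have a0 kl : 0 <= a kl by exact/fine_ge0/cell_sup_ge0.
pose Q := fine (norm1oo q).
have nq0 : (0 <= norm1oo q)%E by apply: esum_ge0 => kl _; exact: cell_sup_ge0.
have QE : norm1oo q = Q%:E by rewrite /Q fineK// ge0_fin_numE.
have Q0 : 0 <= Q by exact: fine_ge0.
have aQ : (\sum_(0 <= n <oo) (a (e n))%:E = Q%:E)%E.
  rewrite -QE -(He (fun kl => (a kl)%:E)) => [|kl]; last by rewrite lee_fin.
  by apply: eq_esum => kl _; rewrite aE.
have qsum (X : Conf R) :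
    (\esum_(xy in points X `*` points X) (normc (q xy.1 xy.2))%:E <=
     \sum_(0 <= n <oo) (a (e n) / 4 * ((count (B (e n).1) X)%:R *
       (count (B (e n).2) X)%:R))%:E)%E.
  rewrite -(He (fun kl => (a kl / 4 * ((count (B kl.1) X)%:R *
       (count (B kl.2) X)%:R))%:E)) => [|kl]; last first.
    by rewrite lee_fin !mulr_ge0// invr_ge0.
  apply: (esum_pairs_le (q := fun x y => normc (q x y)) X a0 _ _ (fun=> erefl)).
  - by move=> x y; exact: normc_ge0.
  - by move=> x y; rewrite normc_eq0; exact: qU.
  - by move=> x y kl xk yl; rewrite -lee_fin aE; exact: cell_sup_ge.
have dom lambda : 0 < lambda -> exists H : Conf R -> \bar R,
  [/\ measurable_fun setT H, forall X, (0 <= H X)%E,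
    (\int[P]_X H X <= (expR (moment_const kap sigma *
       (expR (Q * lambda * sigma) - 1)))%:E)%E &
    forall X, (H X < +oo)%E -> exists2 Y : R,
      (\esum_(xy in points X `*` points X) (normc (q xy.1 xy.2))%:E <= Y%:E)%E &
      ((expR (lambda * Y))%:E <= H X)%E].
  (* When [Q = 0] there are no Jensen weights, but every square contributes 0 and the constant 1 is
     a majorant. *)
  move=> l0; move: Q0; rewrite le_eqVlt => /orP[/eqP Q0|Q0].
    exists (cst 1%E); split=> //.
    - rewrite integral_cst// mul1e -Q0 !mul0r expR0 subrr mulr0 expR0.
      exact: probability_le1.
    - move=> X _; exists 0; last by rewrite mulr0 expR0.
      have an n : a (e n) = 0.
        apply/eqP; rewrite eq_le a0 andbT -lee_fin [leRHS](_ : _ = Q%:E).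
          rewrite -aQ; apply: le_trans (nneseries_lim_ge n.+1 _) => [|m _ _].
            rewrite big_nat_recr//= leeDr//; apply: sume_ge0 => m _.
            by rewrite lee_fin.
          by rewrite lee_fin.
        by rewrite -Q0.
      apply: le_trans (qsum X) _.
      by rewrite eseries0// => n _ _; rewrite an !mul0r.
  have [H [mH H0 IH HY]] := exp_pairs_dominated e s0 l0 Q0 mB Bk tail
    (fun n => a0 (e n)) aQ.
  exists H; split=> // X /HY[Y YH1 YH2]; exists Y => //.
  exact: le_trans (qsum X) _.
split.
  (* Any [lambda] would do: an integrable [H] is finite almost everywhere, and there [Y] bounds the
     sum of the moduli. *)
  have [H [mH H0 IH HY]] := dom 1 ltr01.
  have intH : P.-integrable setT H.
    apply/integrableP; split=> //.
    apply: le_lt_trans (ltry (expR (moment_const kap sigma *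
       (expR (Q * 1 * sigma) - 1)))).
    apply: le_trans IH; rewrite le_eqVlt; apply/orP; left; apply/eqP.
    by apply: eq_integral => X _; rewrite gee0_abs.
  apply: filterS (integrable_ae measurableT intH) => X /(_ I) HX.
  have [|Y qY _] := HY X; first by rewrite -ge0_fin_numE.
  rewrite /pair_summable /summable; apply: le_lt_trans (ltry Y).
  apply: le_trans qY; apply: le_esum => xy _.
  by rewrite gee0_abs// lee_fin normc_ge0.
move=> lambda l0; have [H [mH H0 IH HY]] := dom lambda l0.
apply: le_trans IH; rewrite unlock.
apply: le_integral_lower => // X.
have [->|HX] := eqVneq (H X) +oo%E; first by rewrite leey.
have [|Y qY YH] := HY X; first by rewrite lt_neqAle HX leey.
by apply: le_trans YH; rewrite lee_fin; exact: normc_cexp_le.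
Qed.
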